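(* Expansivity is decidable for group cellular automata: there is an algorithm that, given a finite group $G$ and (the local rule of) a group cellular automaton $\mathcal{F}$ on $G$, decides whether $\mathcal{F}$ is expansive.
   Context: For a finite group $G$, $G^{\mathbb{Z}}$ is a group under the componentwise operation, with the product topology of the discrete topologies on the factors; this topology is induced by the metric $d(c,c')=0$ if $c=c'$ and $d(c,c')=2^{-\min\{|j|:\ c_j\neq c'_j\}}$ otherwise. A group cellular automaton (GCA) on $G$ is a continuous group endomorphism $\mathcal{F}:G^{\mathbb{Z}}\to G^{\mathbb{Z}}$ commuting with the shift $\sigma$, $\sigma(c)_i=c_{i+1}$. Every GCA is given by a local rule, i.e. a homomorphism $f:G^{2\rho+1}\to G$ for some $\rho\in\mathbb{N}$ with $\mathcal{F}(c)_i=f(c_{i-\rho},\dots,c_{i+\rho})$ for all $c$ and $i$. As input to an algorithm, a GCA is represented by the (multiplication table of the) finite group $G$ and the finite table of a local rule. An injective GCA is bijective and its inverse is again a GCA. A GCA $\mathcal{F}$ is expansive if it is injective and there is $\epsilon>0$ such that for any two distinct $c,c'\in G^{\mathbb{Z}}$ there is $n\in\mathbb{Z}$ with $d(\mathcal{F}^n(c),\mathcal{F}^n(c'))>\epsilon$. *)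

(* Defs.v *)
From HB Require Import structures.
From mathcomp Require Import all_boot all_order all_algebra all_fingroup.
From mathcomp Require Import all_classical all_reals all_analysis.

Set Implicit Arguments.
Unset Strict Implicit.
Unset Printing Implicit Defensive.

Import Order.TTheory GRing.Theory Num.Theory.

(* Kleene's partial recursive functions.  Arities are not tracked in the type:
   a program is run on a list of arguments and reads a missing argument as 0.
   [RPrec] recurses on, and [RMin] searches for, the first argument. *)
Inductive recfun : Type :=
| RZero
| RSucc
| RProj of nat
| RComp of recfun & seq recfun
| RPrec of recfun & recfun
| RMin of recfun.

(* [evaluates p xs y]: the computation of p on xs halts with result y; [k] in
   [EvalMin] collects the predecessors of the values before the first zero. *)
Inductive evaluates : recfun -> seq nat -> nat -> Prop :=
| EvalZero xs : evaluates RZero xs 0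
| EvalSucc xs : evaluates RSucc xs (nth 0 xs 0).+1
| EvalProj i xs : evaluates (RProj i) xs (nth 0 xs i)
| EvalComp f gs xs ys y :
    evaluates_all gs xs ys -> evaluates f ys y -> evaluates (RComp f gs) xs y
| EvalPrecNil f g y :
    evaluates f [::] y -> evaluates (RPrec f g) [::] y
| EvalPrec0 f g xs y :
    evaluates f xs y -> evaluates (RPrec f g) (0 :: xs) y
| EvalPrecS f g n xs r y :
    evaluates (RPrec f g) (n :: xs) r -> evaluates g [:: n, r & xs] y ->
    evaluates (RPrec f g) (n.+1 :: xs) y
| EvalMin f xs n (k : nat -> nat) :
    (forall m, m < n -> evaluates f (m :: xs) (k m).+1) ->
    evaluates f (n :: xs) 0 -> evaluates (RMin f) xs n
with evaluates_all : seq recfun -> seq nat -> seq nat -> Prop :=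
| EvalNil xs : evaluates_all [::] xs [::]
| EvalCons g gs xs y ys :
    evaluates g xs y -> evaluates_all gs xs ys ->
    evaluates_all (g :: gs) xs (y :: ys).

Scheme evaluates_mut := Minimality for evaluates Sort Prop
with evaluates_all_mut := Minimality for evaluates_all Sort Prop.

Lemma evaluates_det p xs y y' :
  evaluates p xs y -> evaluates p xs y' -> y = y'.
Proof.
move=> h; move: p xs y h y'.
apply: (evaluates_mut (P := fun p xs y => forall y', evaluates p xs y' -> y = y')
  (P0 := fun gs xs ys => forall ys', evaluates_all gs xs ys' -> ys = ys')).
- by move=> xs y' h; inversion h.
- by move=> xs y' h; inversion h.
- by move=> i xs y' h; inversion h.
- move=> f gs xs ys y _ IHgs _ IHf y' h.
  inversion h as [| | |? ? ? zs ? hgs hf| | | |]; subst.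
  by apply: IHf; rewrite (IHgs _ hgs).
- by move=> f g y _ IH y' h; inversion h; subst; apply: IH.
- by move=> f g xs y _ IH y' h; inversion h; subst; apply: IH.
- move=> f g n xs r y _ IHr _ IHg y' h.
  inversion h as [| | | | | |? ? ? ? r' ? hr hg|]; subst.
  by apply: IHg; rewrite (IHr _ hr).
- move=> f xs n k _ IHlt _ IHn y' h.
  inversion h as [| | | | | | |? ? ? k' hlt h0]; subst.
  case: (ltngtP n y') => // lt_n.
  + by have := IHn _ (hlt _ lt_n).
  + by have := IHlt _ lt_n _ h0.
- by move=> xs ys' h; inversion h.
- move=> g gs xs y ys _ IHg _ IHgs ys' h.
  inversion h as [|? ? ? z zs hz hzs]; subst.
  by rewrite (IHg _ hz) (IHgs _ hzs).
Qed.

Definition answers (p : recfun) (input : seq nat) (P : Prop) : Prop :=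
  (P -> evaluates p input 1) /\ (~ P -> evaluates p input 0).

Definition config (gT : finGroupType) : Type := int -> gT.

Definition config_space (gT : finGroupType) : topologicalType :=
  prod_topology (fun _ : int => discrete_topology gT).

Definition config_mul (gT : finGroupType) (c c' : config gT) : config gT :=
  fun i => (c i * c' i)%g.

Definition config_shift (gT : finGroupType) (c : config gT) : config gT :=
  fun i => c (i + 1)%R.

Definition is_gca (gT : finGroupType) (F : config gT -> config gT) : Prop :=
  [/\ continuous (F : config_space gT -> config_space gT),
      forall c c', F (config_mul c c') = config_mul (F c) (F c')
    & forall c, F (config_shift c) = config_shift (F c)].

Definition is_local_rule (gT : finGroupType) (rho : nat)
    (f : (2 * rho).+1.-tuple gT -> gT) (F : config gT -> config gT) : Prop :=
  (forall u v : (2 * rho).+1.-tuple gT,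
     f [tuple (tnth u j * tnth v j)%g | j < (2 * rho).+1] = (f u * f v)%g) /\
  (forall (c : config gT) (i : int),
     F c i = f [tuple c (i - rho%:Z + j%:Z)%R | j < (2 * rho).+1]).

Definition differ_at (gT : finGroupType) (c c' : config gT) : pred nat :=
  fun k => `[< exists j : int, `|j|%N = k /\ c j <> c' j >].

(* No k satisfies [differ_at c c'] exactly when c = c'. *)
Definition config_dist (R : realType) (gT : finGroupType)
    (c c' : config gT) : R :=
  if pselect (exists k, differ_at c c' k) is left ex
  then (2%:R ^- ex_minn ex)%R else 0%R.

(* For bijective F, ['pinv_id setT F] is the inverse of F; the default [id] is
   only used outside the range of F. *)
Definition iterz (T : choiceType) (F : T -> T) (n : int) : T -> T :=
  match n with
  | Posz k => iter k F
  | Negz k => iter k.+1 ('pinv_id setT F)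
  end.

Definition expansive (R : realType) (gT : finGroupType)
    (F : config gT -> config gT) : Prop :=
  injective F /\
  exists eps : R, (0 < eps)%R /\
    forall c c' : config gT, c <> c' ->
      exists n : int, (eps < config_dist R (iterz F n c) (iterz F n c'))%R.

Fixpoint words (T : Type) (s : seq T) (m : nat) : seq (m.-tuple T) :=
  if m is m'.+1 then [seq cons_tuple x w | x <- s, w <- words s m']
  else [:: nil_tuple T].

(* A group element is represented by its position in an enumeration s of gT;
   tables list their values in lexicographic order of the arguments. *)
Definition mul_table (gT : finGroupType) (s : seq gT) : seq nat :=
  [seq index (x * y)%g s | x <- s, y <- s].

Definition rule_table (gT : finGroupType) (s : seq gT) (m : nat)
    (f : m.-tuple gT -> gT) : seq nat :=
  [seq index (f w) s | w <- words s m].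

Definition gca_input (gT : finGroupType) (s : seq gT) (rho : nat)
    (f : (2 * rho).+1.-tuple gT -> gT) : seq nat :=
  [:: size s; CodeSeq.code (mul_table s); rho; CodeSeq.code (rule_table s f)].

(* Main.v *)
Require Import Defs.
From mathcomp Require Import all_boot all_order all_algebra all_fingroup.
From mathcomp Require Import all_classical all_reals all_analysis.
From mathcomp Require Import zify.

(* An injective F is expansive iff no nontrivial space-time diagram, bi-infinite
   in time, is trivial on a half-plane x < a or x > a: translating such a diagram
   away from the origin refutes expansivity, and conversely two orbits close to
   each other at all times differ by a diagram trivial on a wide vertical strip,
   whose first nontrivial column on one side starts a half-plane diagram (only
   2 rho columns are ever needed to the left of a cell).  By compactness the
   absence of such a diagram is witnessed by a finite patch size.

   Their presence is semi-decidable as well.  The traces of half-plane diagrams on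
   2 rho + 1 adjacent columns form a closed shift-invariant subgroup, hence a
   subshift of finite type, given by a finite set C of blocks of some height h.
   That a C-path (a column strip all of whose blocks lie in C) can be followed by
   another one, overlapping it on 2 rho columns, is certified by a finite look-ahead
   N: the last h rows of the second path determine its possible continuations, and
   the continuations over a trivial first path stabilise with the look-ahead.  A set
   D of blocks of C, trivial on 2 rho columns and closed under successors and
   predecessors, then starts a nontrivial half-plane diagram.  Injectivity is
   treated in the same way through the kernel.

   The program searches for a witness of either kind; each witness is checked by
   bounded quantification over patches coded as numbers in base |G|. *)

Set Implicit Arguments.
Unset Strict Implicit.
Unset Printing Implicit Defensive.

Import Order.TTheory GRing.Theory Num.Theory.

(** * Computable functions *)

(* The number k of arguments is fixed because [RComp] can only pass on a fixed
   list of projections. *)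
Definition computable (k : nat) (F : seq nat -> nat) : Prop :=
  exists p, forall xs, size xs = k -> evaluates p xs (F xs).

Definition computables (k : nat) (Fs : seq (seq nat -> nat)) : Prop :=
  exists ps, forall xs, size xs = k -> evaluates_all ps xs [seq F xs | F <- Fs].

Lemma eq_computable k F G :
  (forall xs, F xs = G xs) -> computable k F -> computable k G.
Proof. by move=> eqFG [p pP]; exists p => xs /pP; rewrite eqFG. Qed.

Lemma computables_nil k : computables k [::].
Proof. by exists [::] => xs _; exact: EvalNil. Qed.

Lemma computables_cons k F Fs :
  computable k F -> computables k Fs -> computables k (F :: Fs).
Proof.
by move=> [p pP] [ps psP]; exists (p :: ps) => xs sz; apply: EvalCons; auto.
Qed.

Lemma computable_comp k F Gs :
  computable (size Gs) F -> computables k Gs ->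
  computable k (fun xs => F [seq G xs | G <- Gs]).
Proof.
move=> [p pP] [ps psP]; exists (RComp p ps) => xs sz.
by apply: EvalComp (psP _ sz) _; apply: pP; rewrite size_map.
Qed.

Lemma computable_nth k i : computable k (fun xs => nth 0 xs i).
Proof. by exists (RProj i) => xs _; exact: EvalProj. Qed.

Lemma computables_nth k s : computables k [seq nth 0 ^~ i | i <- s].
Proof.
by elim: s => [|i s IHs] /=;
  [exact: computables_nil | apply: computables_cons => //; exact: computable_nth].
Qed.

(** Used with n = 0, 1, 2: all arguments, or all but the first one or two, are passed on through a
    fixed list of projections. *)
Lemma map_nth_drop n (xs : seq nat) :
  [seq F xs | F <- [seq nth 0 ^~ i | i <- iota n (size xs - n)]] = drop n xs.
Proof.
rewrite -map_comp; apply: (@eq_from_nth _ 0).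
  by rewrite size_map size_iota size_drop.
move=> i; rewrite size_map size_iota => lt_i.
by rewrite (nth_map 0) ?size_iota //= nth_iota // nth_drop.
Qed.

Lemma computable_behead k F :
  computable k F -> computable k.+1 (fun xs => F (behead xs)).
Proof.
move=> cF; have := @computable_comp k.+1 F [seq nth 0 ^~ i | i <- iota 1 k].
rewrite size_map size_iota => /(_ cF (computables_nth _ _)) [p pP].
exists p => xs sz; have := pP _ sz.
by have := map_nth_drop 1 xs; rewrite sz subn1 /= drop1 => ->.
Qed.

Lemma computable_comp_cons k F G :
  computable k.+1 F -> computable k G -> computable k (fun xs => F (G xs :: xs)).
Proof.
move=> cF cG; have := @computable_comp k F (G :: [seq nth 0 ^~ i | i <- iota 0 k]).
rewrite /= size_map size_iota => /(_ cF).
case; first by apply: computables_cons => //; exact: computables_nth.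
move=> p pP; exists p => xs sz; have := pP _ sz.
by have := map_nth_drop 0 xs; rewrite sz subn0 drop0 => ->.
Qed.

Lemma computable_const k n : computable k (fun=> n).
Proof.
elim: n => [|n [p pP]]; first by exists RZero => xs _; exact: EvalZero.
exists (RComp RSucc [:: p]) => xs sz; apply: (@EvalComp _ _ _ [:: n]).
  by apply: EvalCons; [exact: pP | exact: EvalNil].
exact: EvalSucc.
Qed.

Lemma computable_succ k F : computable k F -> computable k (fun xs => (F xs).+1).
Proof.
move=> cF; apply: (@computable_comp k (fun xs => (nth 0 xs 0).+1) [:: F]).
  by exists RSucc => xs _; exact: EvalSucc.
by apply: computables_cons => //; exact: computables_nil.
Qed.

(** The bound is put in front of the arguments, where [RPrec] recurses on it. *)
Lemma computable_rec k (n a : seq nat -> nat) (f : nat -> nat -> seq nat -> nat) :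
  computable k n -> computable k a ->
  computable k.+2 (fun ys => f (nth 0 ys 0) (nth 0 ys 1) (behead (behead ys))) ->
  computable k
    (fun xs => nat_rect (fun=> nat) (a xs) (fun i r => f i r xs) (n xs)).
Proof.
move=> cn [pa paP] [pf pfP].
apply: (@computable_comp_cons k (fun ys =>
  nat_rect (fun=> nat) (a (behead ys)) (fun i r => f i r (behead ys)) (head 0 ys))
  n _ cn).
exists (RPrec pa pf) => -[|m xs] //= [sz].
elim: m => [|m IHm] /=; first by apply: EvalPrec0; exact: paP.
by apply: EvalPrecS IHm _; apply: pfP; rewrite /= sz.
Qed.

Section Operations.

Variables (k : nat) (F G : seq nat -> nat).
Hypotheses (cF : computable k F) (cG : computable k G).

Lemma computable_add : computable k (fun xs => F xs + G xs).
Proof.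
apply: (eq_computable (F := fun xs =>
  nat_rect (fun=> nat) (F xs) (fun _ r => r.+1) (G xs))).
  by move=> xs; elim: (G xs) => [|m /= ->]; rewrite ?addn0 ?addnS.
by apply: computable_rec => //; apply: computable_succ; exact: computable_nth.
Qed.

Lemma computable_pred : computable k (fun xs => (F xs).-1).
Proof.
apply: (eq_computable (F := fun xs =>
  nat_rect (fun=> nat) 0 (fun i _ => i) (F xs))).
  by move=> xs; case: (F xs).
by apply: computable_rec => //; [exact: computable_const | exact: computable_nth].
Qed.

End Operations.

Section MoreOperations.

Variables (k : nat) (F G : seq nat -> nat).
Hypotheses (cF : computable k F) (cG : computable k G).

Lemma computable_sub : computable k (fun xs => F xs - G xs).
Proof.
apply: (eq_computable (F := fun xs =>
  nat_rect (fun=> nat) (F xs) (fun _ r => r.-1) (G xs))).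
  by move=> xs; elim: (G xs) => [|m /= ->]; rewrite ?subn0 ?subnS.
by apply: computable_rec => //; apply: computable_pred; exact: computable_nth.
Qed.

Lemma computable_mul : computable k (fun xs => F xs * G xs).
Proof.
apply: (eq_computable (F := fun xs =>
  nat_rect (fun=> nat) 0 (fun _ r => r + F xs) (G xs))).
  by move=> xs; elim: (G xs) => [|m /= ->]; rewrite ?muln0 // mulnS addnC.
apply: computable_rec => //; first exact: computable_const.
by apply: computable_add (computable_nth _ _) _;
  exact: (computable_behead (computable_behead cF)).
Qed.

End MoreOperations.

Lemma computable_exp k F G : computable k F -> computable k G ->
  computable k (fun xs => F xs ^ G xs).
Proof.
move=> cF cG; apply: (eq_computable (F := fun xs =>
  nat_rect (fun=> nat) 1 (fun _ r => r * F xs) (G xs))).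
  by move=> xs; elim: (G xs) => [|m /= ->]; rewrite ?expn0 // expnSr.
apply: computable_rec => //; first exact: computable_const.
by apply: computable_mul (computable_nth _ _) _;
  exact: (computable_behead (computable_behead cF)).
Qed.

Lemma computable_sum k (n : seq nat -> nat) (F : nat -> seq nat -> nat) :
  computable k n ->
  computable k.+1 (fun ys => F (nth 0 ys 0) (behead ys)) ->
  computable k (fun xs => \sum_(i < n xs) F i xs).
Proof.
move=> cn cF; apply: (eq_computable (F := fun xs =>
  nat_rect (fun=> nat) 0 (fun i r => r + F i xs) (n xs))).
  by move=> xs; elim: (n xs) => [|m /= ->]; rewrite ?big_ord0 // big_ord_recr.
apply: computable_rec => //; first exact: computable_const.
apply: computable_add; first exact: computable_nth.
(* The summand sees only the index and xs, so the projections skip the accumulator in position 1. *)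
have := @computable_comp k.+2 (fun ys => F (nth 0 ys 0) (behead ys))
  (nth 0 ^~ 0 :: [seq nth 0 ^~ i | i <- iota 2 k]).
rewrite /= size_map size_iota => /(_ cF).
case; first by apply: computables_cons; [exact: computable_nth | exact: computables_nth].
move=> p pP; exists p => xs sz; have := pP _ sz.
by have := map_nth_drop 2 xs; rewrite sz subn2 /= -drop1 -drop1 drop_drop => ->.
Qed.

(** * Decidable predicates, bounded quantifiers and unbounded search *)

Definition decidable_pred (k : nat) (b : seq nat -> bool) : Prop :=
  computable k (fun xs => b xs : nat).

Section Predicates.

Variable k : nat.

Lemma decidable_leq F G : computable k F -> computable k G ->
  decidable_pred k (fun xs => F xs <= G xs).
Proof.
move=> cF cG; apply: (eq_computable (F := fun xs => 1 - (F xs - G xs))).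
  by move=> xs; rewrite -subn_eq0; case: (F xs - G xs).
by do 2?apply: computable_sub => //; exact: computable_const.
Qed.

Lemma decidable_neg b : decidable_pred k b -> decidable_pred k (fun xs => ~~ b xs).
Proof.
move=> cb; apply: (eq_computable (F := fun xs => 1 - b xs)).
  by move=> xs; case: (b xs).
by apply: computable_sub => //; exact: computable_const.
Qed.

Lemma decidable_and b c : decidable_pred k b -> decidable_pred k c ->
  decidable_pred k (fun xs => b xs && c xs).
Proof.
move=> cb cc; apply: (eq_computable (F := fun xs => b xs * c xs)).
  by move=> xs; rewrite mulnb.
exact: computable_mul.
Qed.

Lemma decidable_or b c : decidable_pred k b -> decidable_pred k c ->
  decidable_pred k (fun xs => b xs || c xs).
Proof.
move=> cb cc; apply: (eq_computable (F := fun xs => ~~ (~~ b xs && ~~ c xs))).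
  by move=> xs; rewrite negb_and !negbK.
by apply/decidable_neg/decidable_and; exact: decidable_neg.
Qed.

Lemma decidable_imply b c : decidable_pred k b -> decidable_pred k c ->
  decidable_pred k (fun xs => b xs ==> c xs).
Proof.
move=> cb cc; apply: (eq_computable (F := fun xs => ~~ b xs || c xs)).
  by move=> xs; rewrite implybE.
by apply: decidable_or => //; exact: decidable_neg.
Qed.

Lemma decidable_eq F G : computable k F -> computable k G ->
  decidable_pred k (fun xs => F xs == G xs).
Proof.
move=> cF cG; apply: (eq_computable
    (F := fun xs => (F xs <= G xs) && (G xs <= F xs))).
  by move=> xs; rewrite eqn_leq.
by apply: decidable_and; exact: decidable_leq.
Qed.

End Predicates.

Definition all_lt (n : nat) (P : pred nat) : bool := all P (iota 0 n).
Definition has_lt (n : nat) (P : pred nat) : bool := has P (iota 0 n).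

Lemma all_ltP n (P : pred nat) : reflect (forall i, i < n -> P i) (all_lt n P).
Proof.
apply: (iffP allP) => h i; first by move=> lt_i; apply: h; rewrite mem_iota.
by rewrite mem_iota; exact: h.
Qed.

Lemma has_ltP n (P : pred nat) : reflect (exists2 i, i < n & P i) (has_lt n P).
Proof.
apply: (iffP hasP) => -[i lt_i Pi]; exists i => //; by rewrite mem_iota in lt_i *.
Qed.

(** The counterexamples below the bound are counted by a sum, and the count is compared with
    zero. *)
Lemma decidable_all_lt k n (P : nat -> seq nat -> bool) :
  computable k n ->
  decidable_pred k.+1 (fun ys => P (nth 0 ys 0) (behead ys)) ->
  decidable_pred k (fun xs => all_lt (n xs) (fun i => P i xs)).
Proof.
move=> cn cP; apply: (eq_computable
    (F := fun xs => \sum_(i < n xs) ~~ P i xs == 0)).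
  move=> xs; congr nat_of_bool; rewrite sum_nat_eq0; apply/forallP/all_ltP.
    by move=> h i lt_i; have := h (Ordinal lt_i); rewrite /= eqb0 negbK.
  by move=> h i; rewrite /= eqb0 negbK h.
apply: decidable_eq; last exact: computable_const.
apply: (computable_sum (F := fun i xs => ~~ P i xs)) => //.
exact: decidable_neg.
Qed.

Lemma decidable_has_lt k n (P : nat -> seq nat -> bool) :
  computable k n ->
  decidable_pred k.+1 (fun ys => P (nth 0 ys 0) (behead ys)) ->
  decidable_pred k (fun xs => has_lt (n xs) (fun i => P i xs)).
Proof.
move=> cn cP; apply: (eq_computable
    (F := fun xs => ~~ all_lt (n xs) (fun i => ~~ P i xs))).
  move=> xs; congr nat_of_bool; rewrite /all_lt -has_predC.
  by apply: eq_has => i /=; rewrite negbK.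
apply/decidable_neg/(decidable_all_lt (P := fun i xs => ~~ P i xs)) => //.
exact: decidable_neg.
Qed.

(** Lets a quotient or a valuation be computed as the number of indices below it. *)
Lemma sum_ltn_ord q m : q <= m -> \sum_(i < m) (i < q) = q.
Proof.
move=> le_qm; rewrite -(big_mkord xpredT (fun i => nat_of_bool (i < q))).
rewrite (big_cat_nat (n := q)) //= big_nat (eq_bigr (fun=> 1)); last first.
  by move=> i /= ->.
rewrite -big_nat sum_nat_const_nat subn0 muln1 big_nat big1 ?addn0 // => i.
by case/andP => le_qi _; rewrite ltnNge le_qi.
Qed.

(** The quotient counts the i with (i + 1) G <= F; the test 0 < G reproduces the convention that
    division by zero gives 0. *)
Lemma computable_div k F G : computable k F -> computable k G ->
  computable k (fun xs => F xs %/ G xs).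
Proof.
move=> cF cG; apply: (eq_computable (F := fun xs =>
  \sum_(i < F xs) ((0 < G xs) && (i.+1 * G xs <= F xs)))).
  move=> xs; have [->|G_gt0] := posnP (G xs); first by rewrite divn0 big1.
  under eq_bigr => i _ do rewrite -leq_divRL //.
  by rewrite sum_ltn_ord // leq_div.
apply: (computable_sum (F := fun i xs => (0 < G xs) && (i.+1 * G xs <= F xs))) => //.
by apply: decidable_and; apply: decidable_leq;
  try (apply: computable_mul; first (apply: computable_succ; exact: computable_nth));
  try apply: computable_behead => //; exact: computable_const.
Qed.

Lemma computable_mod k F G : computable k F -> computable k G ->
  computable k (fun xs => F xs %% G xs).
Proof.
move=> cF cG; apply: (eq_computable (F := fun xs => F xs - F xs %/ G xs * G xs)).
  by move=> xs; rewrite {1}(divn_eq (F xs) (G xs)) addKn.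
by apply: computable_sub => //; apply: computable_mul => //; exact: computable_div.
Qed.

(** The search for the least z with A or B halts because P or its negation supplies a witness. A is
    then evaluated at this z, and soundness of both kinds of witness makes its value the answer. The
    program is fixed before xs and P are. *)
Lemma computable_search k (A B : seq nat -> bool) :
  decidable_pred k.+1 A -> decidable_pred k.+1 B ->
  exists p, forall xs (P : Prop), size xs = k ->
    (P -> exists z, A (z :: xs)) -> (~ P -> exists z, B (z :: xs)) ->
    (forall z, A (z :: xs) -> P) -> (forall z, B (z :: xs) -> ~ P) ->
    answers p xs P.
Proof.
move=> cA cB; have [q qP] := decidable_neg (decidable_or cA cB).
have [pA pAP] := cA.
have [ps psP] := computables_nth k (iota 0 k).
exists (RComp pA (RMin q :: ps)) => xs P sz PA NPB AP BP.
have evalP z : A (z :: xs) || B (z :: xs) ->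
    (forall z', z' < z -> ~~ (A (z' :: xs) || B (z' :: xs))) ->
    evaluates (RComp pA (RMin q :: ps)) xs (A (z :: xs)).
  move=> ABz minz; apply: (@EvalComp _ _ _ (z :: xs)).
    apply: EvalCons.
      apply: (@EvalMin _ _ _ (fun=> 0)).
        by move=> m /minz ABm; have := qP (m :: xs); rewrite ABm; apply; rewrite /= sz.
      by have := qP (z :: xs); rewrite ABz; apply; rewrite /= sz.
    by have := psP _ sz; have := map_nth_drop 0 xs; rewrite sz subn0 drop0 => ->.
  by apply: pAP; rewrite /= sz.
have exAB : exists z, A (z :: xs) || B (z :: xs).
  by have [/PA|/NPB] := EM P; case=> z ABz; exists z; rewrite ABz ?orbT.
pose z := ex_minn exAB.
have [ABz minz] : (A (z :: xs) || B (z :: xs)) /\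
    (forall z', z' < z -> ~~ (A (z' :: xs) || B (z' :: xs))).
  rewrite /z; case: ex_minnP => z0 ABz0 minz0; split=> // z' lt_z'.
  by apply: contraL lt_z' => /minz0; rewrite -leqNgt.
have := evalP _ ABz minz; split=> hP.
  suff -> : 1 = A (z :: xs) by [].
  by case/orP: ABz => [-> //|/BP /(_ hP)].
suff -> : 0 = A (z :: xs) by [].
by case: (boolP (A (z :: xs))) => // /AP /hP.
Qed.

(** * Codes, compactness and certificates *)

Definition digit (b x k : nat) : nat := x %/ b ^ k %% b.

Lemma digit_surj b (u : nat -> nat) M :
  (forall k, u k < b) -> exists2 x, x < b ^ M & forall k, k < M -> digit b x k = u k.
Proof.
elim: M u => [|M IHM] u u_lt; first by exists 0; rewrite ?expn0.
have [x lt_x xE] := IHM (u \o succn) (fun k => u_lt k.+1).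
have b_gt0 : 0 < b by apply: leq_ltn_trans (u_lt 0).
exists (x * b + u 0).
  rewrite expnSr (leq_trans (n := x.+1 * b)) //; last by rewrite leq_mul2r lt_x orbT.
  by rewrite mulSn addnC ltn_add2r.
case=> [|k] lt_k; first by rewrite /digit expn0 divn1 modnMDl modn_small.
by rewrite -[RHS](xE k) // /digit expnS divnMA divnMDl // (divn_small (u_lt 0)) addn0.
Qed.

(** An ultrafilter containing all tails selects at each i the value that x n i takes for almost all
    n; finitely many such conditions and a tail still have a common n. *)
Lemma ultra_compact (I : eqType) (A : finType) (x : nat -> I -> A) :
  exists y, forall (s : seq I) m, exists2 n, m <= n & {in s, x n =1 y}.
Proof.
have [U [UU leU]] := ultraFilterLemma eventually_filter.
have PU : ProperFilter U := ultra_proper (UltraFilter := UU).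
have exA i : exists a, U [set n | x n i = a]%classic.
  apply: contrapT => /forallNP nU.
  have {}nU a : U [set n | x n i <> a]%classic.
    by have [/nU|] := in_ultra_setVsetC [set n | x n i = a]%classic UU.
  by have [n /(_ (x n i))] := filter_ex (filter_forall (filter_filter (F := U)) nU).
have [y yP] := choice exA; exists y => s m.
have Us : U [set n | {in s, x n =1 y}]%classic.
  elim: s => [|i s IHs]; first by apply: filterS (@filterT _ U _).
  apply: filterS2 (yP i) IHs => n /= xi xs j; rewrite inE => /orP[/eqP->|] //.
  exact: xs.
have [n [nm ns]] := filter_ex (filterI (leU _ (nbhs_infty_ge m)) Us).
by exists n.
Qed.

(** A term of least cardinality equals all later ones. *)
Lemma decreasing_stab (T : finType) (S : nat -> {set T}) :
  (forall n, S n.+1 \subset S n) -> exists m, forall n, m <= n -> S n = S m.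
Proof.
move=> decS.
have leS m n : m <= n -> S n \subset S m.
  elim: n => [|n IHn]; first by rewrite leqn0 => /eqP->.
  by rewrite leq_eqVlt => /predU1P[->|/IHn]; [exact: subxx | exact: fintype.subset_trans].
have exc : exists c, `[< exists m, #|S m| = c >] by exists #|S 0|; apply/asboolP; exists 0.
case: (ex_minnP exc) => c /asboolP[m <-] minc; exists m => n /leS sub.
apply/eqP; rewrite eqEcard sub minc //; apply/asboolP; by exists n.
Qed.

(* A number C stands for the set of codes y such that [bit C y]. *)
Definition bit (C y : nat) : bool := digit 2 C y == 1.

(** P is an arbitrary proposition: this is how sets defined through infinite diagrams become numbers
    that the program can find. *)
Lemma bit_surj (P : nat -> Prop) M :
  exists C, forall y, y < M -> bit C y = `[< P y >].
Proof.
have [|C _ CE] := @digit_surj 2 (fun y => `[< P y >]) M; first by move=> k; case: asbool.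
by exists C => y lt_y; rewrite /bit CE //; case: asbool.
Qed.

(* Both the numeric checks run by the program and the ones reasoned about in the
   group are instances: a code x is read as the word [rd x], and a patch with W
   columns stores the cell in row t and column i at position t * W + i. *)
Section Checks.

Variables (T : eqType) (one : T) (rd : nat -> nat -> T) (phi : (nat -> T) -> T).
Variables (g rho : nat).

(** Injectivity at a finite scale: some n passes exactly when no kernel element is nontrivial. *)
Definition inj_check (n : nat) : bool :=
  all_lt (g ^ (2 * n + (2 * rho).+1)) (fun x =>
    all_lt (2 * n).+1 (fun i => phi (fun j => rd x (i + j)) == one) ==>
    (rd x n == one)).

(** D is a set of windows in a de Bruijn graph, all sent to 1 and without sources or sinks, so that
    bi-infinite walks in D spell kernel elements. *)
Definition inj_cert (D : nat) : bool :=
  has_lt (g ^ (2 * rho).+1) (fun x => bit D x && (rd x 0 != one)) &&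
  all_lt (g ^ (2 * rho).+1) (fun x => bit D x ==>
    (phi (fun j => rd x j) == one) &&
    (has_lt (g ^ (2 * rho).+1) (fun y => bit D y &&
       all_lt (2 * rho) (fun j => rd y j == rd x (1 + j))) &&
     has_lt (g ^ (2 * rho).+1) (fun y => bit D y &&
       all_lt (2 * rho) (fun j => rd y (1 + j) == rd x j)))).

(** The patch has 2 n + 1 rows and n + 2 rho + 1 columns. If its first 2 rho columns are trivial and
    the rule holds inside, the next column has to be trivial in the middle row. Some n passes
    exactly when [defective] fails. *)
Definition trivial_check (n : nat) : bool :=
  all_lt (g ^ ((2 * n).+1 * (n + (2 * rho).+1))) (fun x =>
    all_lt (2 * n).+1 (fun t => all_lt (2 * rho) (fun i =>
      rd x (t * (n + (2 * rho).+1) + i) == one)) ==>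
    (all_lt (2 * n) (fun t => all_lt n.+1 (fun i =>
      phi (fun j => rd x (t * (n + (2 * rho).+1) + (i + j))) ==
      rd x (t.+1 * (n + (2 * rho).+1) + (i + rho)))) ==>
    (rd x (n * (n + (2 * rho).+1) + 2 * rho) == one))).

Definition in_lang (h C x a : nat) : bool :=
  has_lt (g ^ (h * (2 * rho).+1)) (fun y => bit C y &&
    all_lt (h * (2 * rho).+1) (fun k => rd y k == rd x (a * (2 * rho).+1 + k))).

Definition is_path (h C L x : nat) : bool :=
  all_lt (L.+1 - h) (fun a => in_lang h C x a).

(** The strip v lies one column to the right of x, both having width 2 rho + 1. *)
Definition follows (L x v : nat) : bool :=
  all_lt L (fun t => all_lt (2 * rho) (fun i =>
    rd v (t * (2 * rho).+1 + i) == rd x (t * (2 * rho).+1 + i.+1))).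

(** In a strip of width 2 rho + 1 the rule determines only the middle cell of the next row. *)
Definition lang_cert (h C : nat) : bool :=
  all_lt (g ^ (h * (2 * rho).+1)) (fun y => bit C y ==>
    all_lt h.-1 (fun t => phi (fun j => rd y (t * (2 * rho).+1 + j)) ==
                        rd y (t.+1 * (2 * rho).+1 + rho))).

Definition start_cert (h N C : nat) : bool :=
  all_lt (g ^ ((h + N).+1 * (2 * rho).+1)) (fun x => is_path h C (h + N) x ==>
    has_lt (g ^ ((h + N).+1 * (2 * rho).+1)) (fun v =>
      is_path h C (h + N) v && follows (h + N) x v)).

(** A follower grows by one row: its first h rows are kept, while the N rows of look-ahead after
    them may be replaced. *)
Definition step_cert (h N C : nat) : bool :=
  all_lt (g ^ ((h + N).+1 * (2 * rho).+1)) (fun x =>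
  all_lt (g ^ ((h + N).+1 * (2 * rho).+1)) (fun v =>
    is_path h C (h + N).+1 x && (is_path h C (h + N) v && follows (h + N) x v) ==>
    has_lt (g ^ ((h + N).+1 * (2 * rho).+1)) (fun v' =>
      is_path h C (h + N).+1 v' && (follows (h + N).+1 x v' &&
      all_lt (h * (2 * rho).+1) (fun k => rd v' k == rd v k))))).

(** Again a graph without sources or sinks, now on blocks of h rows: its walks are strips trivial
    except in their last column. *)
Definition column_cert (h C D : nat) : bool :=
  has_lt (g ^ (h * (2 * rho).+1)) (fun x => bit D x && (rd x (2 * rho) != one)) &&
  all_lt (g ^ (h * (2 * rho).+1)) (fun x => bit D x ==>
    (bit C x && all_lt h (fun t => all_lt (2 * rho) (fun i =>
       rd x (t * (2 * rho).+1 + i) == one))) &&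
    (has_lt (g ^ (h * (2 * rho).+1)) (fun y => bit D y &&
       all_lt (h.-1 * (2 * rho).+1) (fun k => rd y k == rd x ((2 * rho).+1 + k))) &&
     has_lt (g ^ (h * (2 * rho).+1)) (fun y => bit D y &&
       all_lt (h.-1 * (2 * rho).+1) (fun k => rd y ((2 * rho).+1 + k) == rd x k)))).

Definition defect_cert (h N C D : nat) : bool :=
  (1 < h) && (lang_cert h C && (start_cert h N C &&
    (step_cert h N C && column_cert h C D))).

End Checks.

Lemma eq_all_lt n P Q : (forall i, i < n -> P i = Q i) -> all_lt n P = all_lt n Q.
Proof. by move=> eqPQ; apply: eq_in_all => i; rewrite mem_iota => /eqPQ. Qed.

Lemma eq_has_lt n P Q : (forall i, i < n -> P i = Q i) -> has_lt n P = has_lt n Q.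
Proof. by move=> eqPQ; apply: eq_in_has => i; rewrite mem_iota => /eqPQ. Qed.

(** Common to both kinds of certificate: letters of a configuration (b = 1) and rows of a strip (b =
    2 rho + 1), in blocks of h units that overlap in h - 1. Units are appended by induction on q,
    then put in front by induction on p. *)
Lemma path_extend (T : Type) (b h : nat) (D : (nat -> T) -> Prop) :
  0 < h ->
  (forall u v, (forall k, k < h * b -> u k = v k) -> D u -> D v) ->
  (forall u, D u -> exists2 v, D v & forall k, k < h.-1 * b -> v k = u (b + k)) ->
  (forall u, D u -> exists2 v, D v & forall k, k < h.-1 * b -> v (b + k) = u k) ->
  forall u p q, D u -> exists2 U : nat -> T,
    forall a, a <= p + q -> D (fun k => U (a * b + k)) &
    forall k, k < h * b -> U (p * b + k) = u k.
Proof.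
move=> h_gt0 locD succD predD u p q Du.
have hbE : h * b = b + h.-1 * b by rewrite -mulSn prednK.
elim: p => [|p [U UD Uu]].
  elim: q => [|q [U UD Uu]].
    exists u; last by [].
    by move=> a; rewrite leqn0 => /eqP->.
  have [v Dv vE] := succD _ (UD _ (leqnn _)).
  pose U' k := if k < (q + h) * b then U k else v (k - q.+1 * b).
  have U'U a k : a <= q -> k < h * b -> U' (a * b + k) = U (a * b + k).
    move=> le_aq lt_k; rewrite /U' ifT // mulnDl.
    by rewrite -addnS leq_add ?leq_mul2r ?le_aq ?orbT.
  exists U' => [a|k lt_k]; last by rewrite U'U // Uu.
  rewrite add0n leq_eqVlt => /predU1P[->|]; last rewrite ltnS => le_aq.
    apply: locD Dv => k lt_k; rewrite /U' addKn; case: ltnP => // lt_qh.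
    rewrite vE; first by rewrite mulSn add0n -addnA addnCA.
    by move: lt_qh; rewrite mulnDl hbE mulSn -addnA addnCA !ltn_add2l.
  by apply: locD (UD a le_aq) => k lt_k; rewrite U'U.
have [v Dv vE] := predD _ (UD _ (leq0n _)).
pose U' k := if k < b then v k else U (k - b).
have U'U k : U' (b + k) = U k by rewrite /U' ltnNge leq_addr addKn.
exists U' => [[|a] le_a|k lt_k]; last by rewrite mulSn -addnA U'U Uu.
  apply: locD Dv => k lt_k; rewrite mul0n add0n; case: (ltnP k b) => [lt_kb|le_bk].
    by rewrite /U' lt_kb.
  rewrite -(subnKC le_bk) U'U vE ?mul0n ?add0n //.
  by rewrite -(ltn_add2l b) subnKC // -hbE.
by apply: locD (UD a _) => // k _; rewrite mulSn -addnA U'U.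
Qed.

(** * From failed checks to infinite objects *)

Lemma all_ltPn n (P : pred nat) :
  reflect (exists2 i, i < n & ~~ P i) (~~ all_lt n P).
Proof. by rewrite -has_predC; exact: has_ltP. Qed.

Lemma pointwise_hom1 (gT : finGroupType) (phi : (nat -> gT) -> gT) :
  (forall u v, phi (fun j => u j * v j)%g = (phi u * phi v)%g) ->
  phi (fun=> 1%g) = 1%g.
Proof.
by move=> phiM; apply: (mulgI (phi (fun=> 1%g))); rewrite -phiM !mulg1.
Qed.

Section Codes.

Variables (gT : finGroupType) (g rho : nat) (rd : nat -> nat -> gT).
Variable phi : (nat -> gT) -> gT.
Hypothesis rd_surj : forall (u : nat -> gT) M,
  exists2 x, x < g ^ M & forall k, k < M -> rd x k = u k.
Hypothesis phi_ext : forall u v,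
  (forall j, j < (2 * rho).+1 -> u j = v j) -> phi u = phi v.
Hypothesis phiM : forall u v, phi (fun j => u j * v j)%g = (phi u * phi v)%g.

Local Notation w := (2 * rho).+1.
Local Notation inj_check := (inj_check 1%g rd phi g rho).
Local Notation inj_cert := (inj_cert 1%g rd phi g rho).
Local Notation trivial_check := (trivial_check 1%g rd phi g rho).

(** Windows start at i instead of being centred there; the kernel is shift-invariant, so a
    nontrivial element exists for one convention exactly when it does for the other. *)
Definition in_kernel (c : int -> gT) : Prop :=
  forall i : int, phi (fun j => c (i + j%:Z)%R) = 1%g.

Lemma ex_kernel : (forall n, ~~ inj_check n) -> exists2 c, in_kernel c & c 0%R != 1%g.
Proof.
move=> nchk.
have /choice[x xP] : forall n, exists x,
    (forall i, i < (2 * n).+1 -> phi (fun j => rd x (i + j)) = 1%g) /\ rd x n != 1%g.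
  move=> n; have /all_ltPn[x _] := nchk n.
  rewrite negb_imply => /andP[/all_ltP ker x_n]; exists x; split=> // i /ker.
  exact: eqP.
(* Position n becomes the origin. For i < - n [absz] reads a wrong cell, but each fixed i avoids
   this once n is large. *)
have [y yP] := ultra_compact (fun n (i : int) => rd (x n) (absz (n%:Z + i)%R)).
exists y => [i|]; last first.
  have [n _ <-] := yP [:: 0%R] 0; last by rewrite inE.
  by rewrite addr0; case: (xP n).
have [n le_n xE] := yP [seq (i + j%:Z)%R | j <- iota 0 w] (absz i).
have [ker _] := xP n.
rewrite -(ker (absz (n%:Z + i)%R)); last by lia.
apply: phi_ext => j lt_j; rewrite -xE; last first.
  by apply/mapP; exists j; rewrite // mem_iota.
by congr rd; lia.
Qed.

(** The windows occurring in c form D; moving by one cell in c gives successors and predecessors. *)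
Lemma inj_cert_complete c : in_kernel c -> c 0%R != 1%g -> exists D, inj_cert D.
Proof.
move=> ker c0.
pose P y := exists i : int, forall j, j < w -> rd y j = c (i + j%:Z)%R.
have [D DE] := bit_surj P (g ^ w).
have exP i : exists2 y, y < g ^ w & bit D y /\ forall j, j < w -> rd y j = c (i + j%:Z)%R.
  have [y lt_y yE] := rd_surj (fun j => c (i + j%:Z)%R) w.
  by exists y; rewrite // DE //; split => //; apply/asboolP; exists i.
exists D; apply/andP; split.
  have [y lt_y [Dy yE]] := exP 0%R; apply/has_ltP; exists y; rewrite // Dy.
  by rewrite yE ?addr0.
apply/all_ltP => x lt_x; apply/implyP; rewrite DE // => /asboolP[i xE].
apply/andP; split; first by rewrite -(ker i); apply/eqP/phi_ext.
apply/andP; split; apply/has_ltP.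
  have [y lt_y [Dy yE]] := exP (i + 1)%R; exists y; rewrite // Dy.
  by apply/all_ltP => j lt_j; rewrite yE 1?ltnW // xE; [apply/eqP; congr c; lia | lia].
have [y lt_y [Dy yE]] := exP (i - 1)%R; exists y; rewrite // Dy.
by apply/all_ltP => j lt_j; rewrite yE ?xE; [apply/eqP; congr c; lia | lia..].
Qed.

(** A walk in D through its distinguished window, n steps each way, spells a counterexample to the
    check of size n. *)
Lemma inj_cert_sound D n : inj_cert D -> ~~ inj_check n.
Proof.
case/andP => /has_ltP[x0 lt_x0 /andP[Dx0 x00]] /all_ltP certD.
pose Dp u := exists2 y, y < g ^ w & bit D y /\ forall k, k < w * 1 -> rd y k = u k.
have [|||||U UD UE] := @path_extend _ 1 w Dp _ _ _ _ (rd x0) n n _ => //.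
- move=> u v uv [y lt_y [Dy yE]]; exists y => //; split=> // k lt_k.
  by rewrite yE // uv.
- move=> u [y lt_y [Dy yE]]; have /implyP/(_ Dy)/and3P[_ + _] := certD _ lt_y.
  case/has_ltP => z lt_z /andP[Dz /all_ltP zE]; exists (rd z) => [|k lt_k].
    by exists z.
  by rewrite (eqP (zE k _)) ?yE //; lia.
- move=> u [y lt_y [Dy yE]]; have /implyP/(_ Dy)/and3P[_ _] := certD _ lt_y.
  case/has_ltP => z lt_z /andP[Dz /all_ltP zE]; exists (rd z) => [|k lt_k].
    by exists z.
  by rewrite (eqP (zE k _)) ?yE //; lia.
- by exists x0.
have [x lt_x xE] := rd_surj U (2 * n + w).
apply/all_ltPn; exists x => //; rewrite negb_imply; apply/andP; split; last first.
  rewrite xE; last by lia.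
  by have := UE 0; rewrite !muln1 addn0 => ->.
apply/all_ltP => i lt_i; have [|y lt_y [Dy yE]] := UD i; first by lia.
have /implyP/(_ Dy)/andP[/eqP<- _] := certD _ lt_y; apply/eqP/phi_ext => j lt_j.
by rewrite yE muln1 // xE //; lia.
Qed.

(** Columns are numbered from the edge. The first rho columns are not determined by the previous
    row, since their windows leave the half-plane. *)
Definition half_plane (d : int -> nat -> gT) : Prop :=
  forall t i, d (t + 1)%R (i + rho) = phi (fun j => d t (i + j)).

(** With 2 rho trivial columns at its edge, d continues by 1 to a diagram on the whole plane. *)
Definition defective : Prop := exists d, [/\ half_plane d,
  forall t i, i < 2 * rho -> d t i = 1%g & d 0%R (2 * rho) != 1%g].

(** Compactness, with the middle row of each counterexample moved to time 0. *)
Lemma ex_defect : (forall n, ~~ trivial_check n) -> defective.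
Proof.
move=> nchk.
have /choice[x xP] : forall n, exists u : nat -> nat -> gT,
  [/\ forall t i, t < (2 * n).+1 -> i < 2 * rho -> u t i = 1%g,
      forall t i, t < 2 * n -> i < n.+1 -> u t.+1 (i + rho) = phi (fun j => u t (i + j))
    & u n (2 * rho) != 1%g].
  move=> n; have /all_ltPn[x _] := nchk n.
  rewrite !negb_imply => /and3P[/all_ltP left1 /all_ltP valid x_n].
  exists (fun t i => rd x (t * (n + w) + i)); split => // t i lt_t lt_i.
    exact: eqP (all_ltP _ _ (left1 t lt_t) i lt_i).
  by rewrite (eqP (all_ltP _ _ (valid t lt_t) i lt_i)).
have [y yP] := ultra_compact (fun n (ti : int * nat) => x n (absz (n%:Z + ti.1)%R) ti.2).
exists (fun t i => y (t, i)); split=> [t i|t i lt_i|].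
- have [n le_n xE] := yP ((t + 1, i + rho)%R :: [seq (t, i + j) | j <- iota 0 w])
                        (absz t + i + 1).
  have [_ valid _] := xP n.
  rewrite -xE ?mem_head //=.
  have -> : absz (n%:Z + (t + 1))%R = (absz (n%:Z + t)%R).+1 by lia.
  rewrite valid; [|lia|lia]; apply: phi_ext => j lt_j.
  by rewrite -xE // inE; apply/orP; right; apply/mapP; exists j; rewrite // mem_iota.
- have [n le_n <-] := yP [:: (t, i)] (absz t); last by rewrite inE.
  by have [left1 _ _] := xP n; apply: left1 => //=; lia.
- have [n le_n <-] := yP [:: (0%R, 2 * rho)] 0; last by rewrite inE.
  by rewrite addr0; case: (xP n).
Qed.

End Codes.

(** * Soundness of defect certificates *)

Lemma divn_cell W t i : i < W -> (t * W + i) %/ W = t.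
Proof. by move=> lt_i; rewrite divnMDl ?divn_small ?addn0 //; apply: leq_ltn_trans lt_i. Qed.

Lemma modn_cell W t i : i < W -> (t * W + i) %% W = i.
Proof. by move=> lt_i; rewrite modnMDl modn_small. Qed.

Lemma ltn_cell W t i n : t < n -> i < W -> t * W + i < n * W.
Proof.
move=> lt_t lt_i; apply: leq_trans (_ : t.+1 * W <= _); last by rewrite leq_mul2r lt_t orbT.
by rewrite mulSn addnC ltn_add2r.
Qed.

Section Languages.

Variables (gT : finGroupType) (g rho : nat) (rd : nat -> nat -> gT).
Local Notation w := (2 * rho).+1.

Variables (h C : nat).

Definition block (u : nat -> gT) : Prop := exists2 y, y < g ^ (h * w) &
  bit C y /\ forall k, k < h * w -> rd y k = u k.

Definition block_path (L : nat) (u : nat -> gT) : Prop :=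
  forall a, a + h <= L -> block (fun k => u (a * w + k)).

Lemma eq_block u v : (forall k, k < h * w -> u k = v k) -> block u -> block v.
Proof.
move=> uv [y lt_y [Cy yE]]; exists y => //; split=> // k lt_k.
by rewrite yE // uv.
Qed.

Lemma eq_block_path L u v :
  (forall k, k < L * w -> u k = v k) -> block_path L u -> block_path L v.
Proof.
move=> uv pu a le_a; apply: eq_block (pu a le_a) => k lt_k; apply: uv.
apply: leq_trans (_ : (a + h) * w <= _); first by rewrite mulnDl ltn_add2l.
by rewrite leq_mul2r le_a orbT.
Qed.

Lemma is_pathP L x : reflect (block_path L (rd x)) (is_path rd g rho h C L x).
Proof.
apply: (iffP (all_ltP _ _)) => pth a.
  move=> le_a; have lt_a : a < L.+1 - h by lia.
  have /has_ltP[y lt_y /andP[Cy /all_ltP yE]] := pth a lt_a.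
  by exists y => //; split=> // k /yE /eqP.
move=> lt_a; have [|y lt_y [Cy yE]] := pth a; first by lia.
apply/has_ltP; exists y; rewrite // Cy; apply/all_ltP => k /yE ->; exact: eqxx.
Qed.

Lemma followsP L x v : reflect
  (forall t i, t < L -> i < 2 * rho -> rd v (t * w + i) = rd x (t * w + i.+1))
  (follows rd rho L x v).
Proof.
apply: (iffP (all_ltP _ _)) => fol t; first by move=> i /fol /all_ltP h0 /h0 /eqP.
by move=> lt_t; apply/all_ltP => i /(fol t i lt_t) ->.
Qed.

End Languages.

Section Soundness.

Variables (gT : finGroupType) (g rho : nat) (rd : nat -> nat -> gT).
Variable phi : (nat -> gT) -> gT.
Hypothesis rd_surj : forall (u : nat -> gT) M,
  exists2 x, x < g ^ M & forall k, k < M -> rd x k = u k.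
Hypothesis phi_ext : forall u v,
  (forall j, j < (2 * rho).+1 -> u j = v j) -> phi u = phi v.

Local Notation w := (2 * rho).+1.
Local Notation block_path := (block_path g rho rd).

Variables (h N C D : nat).
Hypotheses (h_gt1 : 1 < h) (langC : lang_cert rd phi g rho h C).
Hypotheses (startC : start_cert rd g rho h N C) (stepC : step_cert rd g rho h N C).
Hypothesis columnC : column_cert 1%g rd g rho h C D.

(** Induction on the height: [startC] gives the first h + N rows, and each further row comes from
    [stepC] applied to the last h + N rows, whose look-ahead is discarded and rebuilt. *)
Lemma block_path_follow L u : h + N <= L -> block_path h C L u ->
  exists2 v, block_path h C L v &
    forall t i, t < L -> i < 2 * rho -> v (t * w + i) = u (t * w + i.+1).
Proof.
move=> /subnK<-; move: (L - (h + N)) => k pu.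
have : exists2 v, block_path h C (k + (h + N)) v & forall t i,
  t < k + (h + N) -> i < 2 * rho -> v (t * w + i) = u (t * w + i.+1); last by [].
elim: k pu => [|k IHk] pu.
  have [x lt_x xE] := rd_surj u ((h + N).+1 * w).
  have px : block_path h C (h + N) (rd x).
    by apply: eq_block_path pu => i lt_i; rewrite xE //; lia.
  have /implyP := all_ltP _ _ startC x lt_x.
  case/(_ (introT (is_pathP _ _ _ _ _ _ _) px))/has_ltP => v lt_v.
  case/andP=> /is_pathP pv /followsP fv; exists (rd v) => // t i lt_t lt_i.
  by rewrite fv // xE // ltn_cell //; lia.
have [|v pv fv] := IHk.
  by move=> a le_a; apply: pu; lia.
have [x lt_x xE] := rd_surj (fun p => u (k * w + p)) ((h + N).+1 * w).
have [y lt_y yE] := rd_surj (fun p => v (k * w + p)) ((h + N).+1 * w).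
have px : block_path h C (h + N).+1 (rd x).
  apply: eq_block_path (_ : block_path h C (h + N).+1 (fun p => u (k * w + p))).
    by move=> i lt_i; rewrite xE.
  move=> a le_a; apply: eq_block (pu (k + a) _); last by lia.
  by move=> i _; congr u; lia.
have py : block_path h C (h + N) (rd y).
  apply: eq_block_path (_ : block_path h C (h + N) (fun p => v (k * w + p))).
    by move=> i lt_i; rewrite yE //; lia.
  move=> a le_a; apply: eq_block (pv (k + a) _); last by lia.
  by move=> i _; congr v; lia.
have fy : follows rd rho (h + N) x y.
  apply/followsP => t i lt_t lt_i; rewrite xE ?yE ?ltn_cell //; [|lia..].
  by rewrite !addnA -!mulnDl fv //; lia.
have /implyP := all_ltP _ _ (all_ltP _ _ stepC x lt_x) y lt_y.
have /is_pathP -> := px; have /is_pathP -> := py; rewrite fy => /(_ isT) /has_ltP[z lt_z].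
case/and3P => /is_pathP pz /followsP fz /all_ltP zE.
(* V is v before row k + h and z from row k on; the overlap of h rows puts every block of V inside
   one of the two. *)
pose V p := if p < (k + h) * w then v p else rd z (p - k * w).
have Vv p : p < (k + h) * w -> V p = v p by rewrite /V => ->.
have Vz p : p < (h + N).+1 * w -> V (k * w + p) = rd z p.
  move=> lt_p; rewrite /V mulnDl ltn_add2l addKn; case: ltnP => // lt_ph.
  by rewrite (eqP (zE _ lt_ph)) yE.
exists V => [a le_a|t i lt_t lt_i].
  have [le_ak|lt_ka] := leqP a k.
    apply: eq_block (pv a _) => [p lt_p|]; last by lia.
    by rewrite Vv // mulnDl -addnS leq_add // leq_mul2r le_ak orbT.
  apply: eq_block (pz (a - k) _) => [p lt_p|]; last by lia.
  rewrite -Vz; first by rewrite addnA -mulnDl subnKC // ltnW.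
  apply: leq_trans (_ : (a - k + h) * w <= _); first by rewrite mulnDl ltn_add2l.
  by rewrite leq_mul2r; apply/orP; right; lia.
have [lt_tk|le_kt] := ltnP t (k + h).
  rewrite Vv ?fv //; first by lia.
  by rewrite ltn_cell //; lia.
have -> : t * w + i = k * w + ((t - k) * w + i).
  by rewrite addnA -mulnDl subnKC //; lia.
rewrite Vz; last by rewrite ltn_cell //; lia.
rewrite fz //; last by lia.
rewrite xE; last by rewrite ltn_cell //; lia.
by rewrite addnA -mulnDl subnKC //; lia.
Qed.

(** Followers are taken m times; each shares 2 rho columns with the patch built so far and adds
    one. *)
Lemma block_path_columns L U m : h + N <= L -> block_path h C L U ->
  exists2 P : nat -> nat -> gT,
    (forall k, k <= m -> block_path h C L (fun p => P (p %/ w) (k + p %% w))) &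
    forall t i, i < w -> P t i = U (t * w + i).
Proof.
move=> le_L pU; elim: m => [|m [P pP PU]].
  exists (fun t i => U (t * w + i)) => // k; rewrite leqn0 => /eqP-> a le_a.
  by apply: eq_block (pU a le_a) => p _; rewrite add0n -divn_eq.
have [v pv fv] := block_path_follow le_L (pP m (leqnn m)).
(* Only the last column of v is new. *)
exists (fun t i => if i <= m + 2 * rho then P t i else v (t * w + 2 * rho)); last first.
  by move=> t i lt_i; rewrite ifT ?PU //; lia.
move=> k; rewrite leq_eqVlt => /predU1P[->|].
  apply: eq_block_path pv => p lt_p.
  have lt_t : p %/ w < L by rewrite ltn_divLR.
  have := ltn_pmod p (ltn0Sn (2 * rho)); rewrite ltnS leq_eqVlt => /predU1P[pE|lt_i].
    rewrite ifF; last by lia.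
    by rewrite [in LHS](divn_eq p w) pE.
  rewrite ifT; last by lia.
  by rewrite {1}(divn_eq p w) fv // divn_cell // modn_cell // addSnnS.
rewrite ltnS => /[dup] le_k /pP; apply: eq_block_path => p _.
by rewrite ifT //; have := ltn_pmod p (ltn0Sn (2 * rho)); lia.
Qed.

(** A walk in D from the distinguished block, n steps back and n + N forth; the extra N makes the
    strip high enough for [block_path_follow]. *)
Lemma defect_path n : exists2 U, block_path h C (2 * n + N + h) U &
  (forall t i, t < 2 * n + N + h -> i < 2 * rho -> U (t * w + i) = 1%g) /\
  U (n * w + 2 * rho) != 1%g.
Proof.
have /andP[/has_ltP[x lt_x /andP[Dx x1]] /all_ltP certD] := columnC.
have h_gt0 : 0 < h := ltnW h_gt1.
have [||||U pU Ux] := @path_extend _ w h (block g rho rd h D) h_gt0 _ _ _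
    (rd x) n (n + N) _.
- exact: eq_block.
- move=> u [y lt_y [Dy yE]]; have /implyP/(_ Dy)/and3P[_ + _] := certD _ lt_y.
  case/has_ltP => z lt_z /andP[Dz /all_ltP zE]; exists (rd z) => [|k lt_k].
    by exists z.
  by rewrite (eqP (zE k lt_k)) yE // -(prednK h_gt0) mulSn ltn_add2l.
- move=> u [y lt_y [Dy yE]]; have /implyP/(_ Dy)/and3P[_ _] := certD _ lt_y.
  case/has_ltP => z lt_z /andP[Dz /all_ltP zE]; exists (rd z) => [|k lt_k].
    by exists z.
  rewrite (eqP (zE k lt_k)) yE //; apply: leq_trans lt_k _.
  by rewrite leq_mul2r leq_pred orbT.
- by exists x.
exists U => [a le_a|].
  have [|y lt_y [Dy yE]] := pU a; first by lia.
  exists y => //; split=> //.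
  by have /implyP/(_ Dy)/andP[/andP[]] := certD _ lt_y.
split=> [t i lt_t lt_i|]; last by rewrite Ux // leq_pmull.
(* Row t is read in the block starting there, or in the last block if t is one of the final rows. *)
pose a := minn t (2 * n + N).
have [|y lt_y [Dy yE]] := pU a; first by lia.
have /implyP/(_ Dy)/andP[/andP[_ /all_ltP left1] _] := certD _ lt_y.
have lt_ta : t - a < h by lia.
have -> : t * w + i = a * w + ((t - a) * w + i).
  by rewrite addnA -mulnDl subnKC //; lia.
rewrite -yE; first exact: eqP (all_ltP _ _ (left1 _ lt_ta) i lt_i).
by rewrite ltn_cell //; lia.
Qed.

(** The strip of a walk in D, widened by its followers, is a patch that breaks the check of size
    n. *)
Lemma defect_cert_sound n : ~~ trivial_check 1%g rd phi g rho n.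
Proof.
have [U pU [U1 Un]] := defect_path n.
have [|P pP PU] := block_path_columns n _ pU; first by lia.
pose W := n + w.
have [x lt_x xE] := rd_surj (fun p => P (p %/ W) (p %% W)) ((2 * n).+1 * W).
have {}xE t i : t < (2 * n).+1 -> i < W -> rd x (t * W + i) = P t i.
  by move=> lt_t lt_i; rewrite xE ?ltn_cell // divn_cell // modn_cell.
apply/all_ltPn; exists x => //; rewrite !negb_imply; apply/and3P; split.
- apply/all_ltP => t lt_t; apply/all_ltP => i lt_i.
  by rewrite xE ?PU ?U1 //; rewrite /W; lia.
- apply/all_ltP => t lt_t; apply/all_ltP => i lt_i.
  have [||y lt_y [Cy yE]] := pP i _ t; [by lia | by lia |].
  have yP t' j : t' < h -> j < w -> rd y (t' * w + j) = P (t + t') (i + j).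
    move=> lt_t' lt_j; rewrite yE ?ltn_cell //.
    by rewrite addnA -mulnDl divn_cell // modn_cell.
  (* The rule is read between the first two rows of the block at row t, hence h > 1. *)
  have /implyP/(_ Cy)/all_ltP/(_ 0) := all_ltP _ _ langC y lt_y.
  rewrite -ltnS prednK ?(ltnW h_gt1) // => /(_ h_gt1)/eqP.
  rewrite yP //; last by lia.
  rewrite addn1 xE; [|lia|rewrite /W; lia].
  move<-; apply/eqP/phi_ext => j lt_j.
  by rewrite yP ?(ltnW h_gt1) // addn0 xE //; rewrite /W; lia.
by rewrite xE ?PU //; rewrite /W; lia.
Qed.

End Soundness.

(** * Completeness of defect certificates *)

Section Completeness.

Variables (gT : finGroupType) (g rho : nat) (rd : nat -> nat -> gT).
Variable phi : (nat -> gT) -> gT.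
Hypothesis rd_surj : forall (u : nat -> gT) M,
  exists2 x, x < g ^ M & forall k, k < M -> rd x k = u k.
Hypothesis phi_ext : forall u v,
  (forall j, j < (2 * rho).+1 -> u j = v j) -> phi u = phi v.
Hypothesis phiM : forall u v, phi (fun j => u j * v j)%g = (phi u * phi v)%g.

Local Notation w := (2 * rho).+1.
Local Notation half_plane := (half_plane rho phi).

Lemma half_planeM d d' : half_plane d -> half_plane d' ->
  half_plane (fun t i => d t i * d' t i)%g.
Proof. by move=> hd hd' t i; rewrite phiM hd hd'. Qed.

Lemma half_planeV d : half_plane d -> half_plane (fun t i => (d t i)^-1)%g.
Proof.
move=> hd t i; apply: (mulgI (d (t + 1)%R (i + rho))).
rewrite mulgV hd -phiM -[LHS](pointwise_hom1 phiM); congr phi.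
by apply: funext => j; rewrite mulgV.
Qed.

Lemma half_plane_time s d : half_plane d -> half_plane (fun t i => d (s + t)%R i).
Proof. by move=> hd t i; rewrite addrA hd. Qed.

(** Dropping the edge column leaves a half-plane diagram, which is why every word of [lang] has a
    follower. *)
Lemma half_plane_column d : half_plane d -> half_plane (fun t i => d t i.+1).
Proof. by move=> hd t i; rewrite -addSn hd. Qed.

Definition lang (n : nat) (u : nat -> gT) : Prop := exists2 d, half_plane d &
  forall t i, t < n -> i < w -> d t%:Z%R i = u (t * w + i).

Lemma eq_lang n u v : (forall k, k < n * w -> u k = v k) -> lang n u -> lang n v.
Proof.
by move=> uv [d hd du]; exists d => // t i lt_t lt_i; rewrite du // uv ?ltn_cell.
Qed.

Lemma lang_sub a n m u : a + m <= n -> lang n u -> lang m (fun k => u (a * w + k)).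
Proof.
move=> le_n [d hd du]; exists (fun t i => d (a%:Z + t)%R i).
  exact: half_plane_time.
by move=> t i lt_t lt_i; rewrite addnA -mulnDl -du //; lia.
Qed.

Definition follower (n : nat) : {set {ffun 'I_w -> gT}} :=
  [set a : {ffun 'I_w -> gT} | `[< exists2 d, half_plane d &
     (forall t i, t < n -> i < w -> d t%:Z%R i = 1%g) /\
     forall i : 'I_w, d n%:Z%R i = a i >]].

(* A closed shift-invariant subgroup is of finite type: once the followers of
   the trivial words of length n have stabilised, so have those of all words,
   a follower set being a coset of that of the trivial word. *)
Lemma lang_finite_type : exists2 h, 1 < h & forall n u, h <= n ->
  (forall a, a + h <= n -> lang h (fun k => u (a * w + k))) -> lang n u.
Proof.
have [n|m stab] := @decreasing_stab _ follower.
  apply/fintype.subsetP => a; rewrite !inE => -[d hd [d1 da]].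
  exists (fun t i => d (1 + t)%R i); first exact: half_plane_time.
  by split=> [t i lt_t lt_i|i]; [rewrite -(d1 t.+1 i) // | rewrite -da];
    congr (d _ _); lia.
(* Height m + 2 ensures h > 1; consecutive blocks overlap in m + 1 rows, where the followers have
   stabilised. *)
exists m.+2 => // n u /subnK <-; move: (n - m.+2) => {}n; elim: n => [|n IHn] pu.
  exact: (pu 0 (leqnn _)).
have [|d1 hd1 d1E] := IHn; first by move=> a le_a; apply: pu; lia.
have [|d2 hd2 d2E] := pu n.+1; first by lia.
pose d2' t i := d2 (- n.+1%:Z + t)%R i.
have hd2' : half_plane d2' := half_plane_time _ hd2.
have d2'E t i : n.+1 <= t -> t < n.+1 + m.+2 -> i < w -> d2' t%:Z%R i = u (t * w + i).
  move=> le_t lt_t lt_i; rewrite /d2'.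
  have -> : (- n.+1%:Z + t%:Z)%R = (t - n.+1)%:Z%R by lia.
  by rewrite d2E //; [rewrite addnA -mulnDl subnKC | lia].
(* On the m + 1 rows that d1 and d2' share the quotient is trivial, so its next row follows a
   trivial word of length m + 1, hence by stability one of length n + m + 2. The diagram d3
   realising this corrects d1 in the last row. *)
pose d t i := ((d1 t i)^-1 * d2' t i)%g.
have hd : half_plane d by apply: half_planeM => //; exact: half_planeV.
pose a := [ffun i : 'I_w => d (n + m.+2)%:Z%R i].
have : a \in follower (n + m.+2).
  rewrite stab; last by lia.
  rewrite -(stab m.+1) // !inE.
  exists (fun t i => d (n.+1%:Z + t)%R i); first exact: half_plane_time.
  split=> [t i lt_t lt_i|i]; last by rewrite ffunE; congr (d _ _); lia.
  have -> : (n.+1%:Z + t%:Z)%R = (n.+1 + t)%:Z%R by lia.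
  by rewrite /d d1E ?d2'E ?mulVg //; lia.
rewrite !inE => -[d3 hd3 [d31 d3a]].
exists (fun t i => d1 t i * d3 t i)%g; first exact: half_planeM.
move=> t i; rewrite addSn ltnS leq_eqVlt => /predU1P[->|lt_t] lt_i; last first.
  by rewrite d31 // mulg1 d1E.
by rewrite -[i]/(val (Ordinal lt_i)) d3a ffunE /d mulKVg d2'E //=; lia.
Qed.

Definition word (d : int -> nat -> gT) (p : nat) : gT := d (p %/ w)%:Z%R (p %% w).

Lemma word_cell d t i : i < w -> word d (t * w + i) = d t%:Z%R i.
Proof. by move=> lt_i; rewrite /word divn_cell ?modn_cell. Qed.

Lemma ex_code n d : exists2 x, x < g ^ (n * w) &
  forall t i, t < n -> i < w -> rd x (t * w + i) = d t%:Z%R i.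
Proof.
have [x lt_x xE] := rd_surj (word d) (n * w); exists x => // t i lt_t lt_i.
by rewrite xE ?word_cell ?ltn_cell.
Qed.

(** First h rows of the followers of a trivial strip of height n; the index where these sets
    stabilise becomes the look-ahead N. *)
Definition fibre (h n : nat) : {set {ffun 'I_h * 'I_w -> gT}} :=
  [set z : {ffun 'I_h * 'I_w -> gT} | `[< exists2 d, half_plane d &
     (forall t i, t < n -> i < 2 * rho -> d t%:Z%R i = 1%g) /\
     forall (t : 'I_h) (i : 'I_w), d t%:Z%R i = z (t, i) >]].

(** C is the language of height h given by [lang_finite_type], and D consists of the blocks at the
    edge of d0 at all times. *)
Lemma defect_cert_complete :
  defective rho phi -> exists h N C D, defect_cert 1%g rd phi g rho h N C D.
Proof.
case=> d0 [hd0 d01 d00].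
have [h h_gt1 glue] := lang_finite_type.
have [n|N stab] := @decreasing_stab _ (fibre h).
  apply/fintype.subsetP => z; rewrite !inE => -[d hd [d1 dz]].
  by exists d => //; split=> // t i lt_t; apply: d1; lia.
have [C CE] := bit_surj (fun y => lang h (rd y)) (g ^ (h * w)).
pose inD y := exists s, forall t i, t < h -> i < w -> rd y (t * w + i) = d0 (s + t%:Z)%R i.
have [D DE] := bit_surj inD (g ^ (h * w)).
have blockP u : block g rho rd h C u <-> lang h u.
  split=> [[y lt_y []]|lu].
    by rewrite CE // => /asboolP ly yE; apply: eq_lang ly.
  have [y lt_y yE] := rd_surj u (h * w); exists y => //; split=> //.
  by rewrite CE //; apply/asboolP; apply: eq_lang lu => k /yE.
have pathP L x : h <= L -> reflect (lang L (rd x)) (is_path rd g rho h C L x).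
  move=> le_L; apply: (iffP (is_pathP _ _ _ _ _ _ _)) => [px|lx a le_a].
    by apply: glue => // a le_a; apply/blockP/px.
  by apply/blockP; apply: lang_sub lx.
have exD s : exists2 y, y < g ^ (h * w) & bit D y /\
    forall t i, t < h -> i < w -> rd y (t * w + i) = d0 (s + t%:Z)%R i.
  have [y lt_y yE] := ex_code h (fun t i => d0 (s + t)%R i).
  by exists y => //; split=> //; rewrite DE //; apply/asboolP; exists s.
have codeS n d : exists2 x, x < g ^ ((h + N).+1 * w) & forall t i, t < n ->
    n <= (h + N).+1 -> i < w -> rd x (t * w + i) = d t%:Z%R i.
  have [x lt_x xE] := ex_code (h + N).+1 d; exists x => // t i lt_t le_n lt_i.
  by rewrite xE //; lia.
have splitk k n : k < n * w -> [/\ k %/ w < n, k %% w < w & k = k %/ w * w + k %% w].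
  by rewrite -ltn_divLR // ltn_pmod // -divn_eq.
exists h, N, C, D; rewrite /defect_cert h_gt1 andTb; apply/and4P; split.
- apply/all_ltP => y lt_y; apply/implyP; rewrite CE // => /asboolP[d hd dE].
  apply/all_ltP => t lt_t; apply/eqP; rewrite -dE; [|lia|lia].
  rewrite intS addrC (hd _ 0); apply: phi_ext => j lt_j.
  by rewrite -dE //; lia.
- apply/all_ltP => x lt_x; apply/implyP => /pathP[|d hd dE]; first by lia.
  have [v lt_v vE] := codeS (h + N) (fun t i => d t i.+1).
  apply/has_ltP; exists v => //; apply/andP; split.
    apply/pathP; first by lia.
    exists (fun t i => d t i.+1); first exact: half_plane_column.
    by move=> t i lt_t lt_i; rewrite vE.
  by apply/followsP => t i lt_t lt_i; rewrite vE -?dE //; lia.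
- apply/all_ltP => x lt_x; apply/all_ltP => v lt_v; apply/implyP.
  case/and3P => /pathP[|d hd dE]; first by lia.
  move=> /pathP[|d' hd' d'E]; first by lia.
  move=> /followsP fv.
  (* The follower d' of d and the shifted diagram differ by an element over the trivial strip of
     height h + N. Stability replaces it by z', trivial one row further and equal on the first h
     rows. *)
  pose z t i := ((d t i.+1)^-1 * d' t i)%g.
  have hd1 : half_plane (fun t i => d t i.+1) := half_plane_column hd.
  have hz : half_plane z by apply: half_planeM => //; exact: half_planeV.
  have : [ffun ti : 'I_h * 'I_w => z ti.1%:Z%R ti.2] \in fibre h (h + N).
    rewrite !inE; exists z => //; split=> [t i lt_t lt_i|t i].
      by rewrite /z d'E ?fv ?dE ?mulVg //; lia.
    by rewrite ffunE.
  rewrite stab ?leq_addl // -(stab (h + N).+1); last by lia.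
  rewrite !inE => -[z' hz' [z'1 z'z]].
  have hv' : half_plane (fun t i => d t i.+1 * z' t i)%g by apply: half_planeM.
  have [v' lt_v' v'E] := codeS (h + N).+1 (fun t i => d t i.+1 * z' t i)%g.
  apply/has_ltP; exists v' => //; apply/and3P; split.
  + apply/pathP; first by lia.
    by exists (fun t i => d t i.+1 * z' t i)%g => // t i lt_t lt_i; rewrite v'E.
  + apply/followsP => t i lt_t lt_i.
    by rewrite v'E ?z'1 ?mulg1 ?dE //; lia.
  + apply/all_ltP => k /splitk[lt_t lt_i ->]; apply/eqP.
    rewrite v'E //; last by lia.
    rewrite -d'E //; last by lia.
    by rewrite (z'z (Ordinal lt_t) (Ordinal lt_i)) ffunE /= /z mulKVg.
- apply/andP; split.
    have [y lt_y [Dy yE]] := exD 0%R; apply/has_ltP; exists y => //; rewrite Dy.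
    by have := yE 0 (2 * rho); rewrite mul0n add0n add0r => -> //; lia.
  apply/all_ltP => x lt_x; apply/implyP; rewrite DE // => /asboolP[s xE].
  apply/and3P; split; [apply/andP; split| |].
  + rewrite CE //; apply/asboolP; exists (fun t i => d0 (s + t)%R i).
      exact: half_plane_time.
    by move=> t i lt_t lt_i; rewrite xE.
  + apply/all_ltP => t lt_t; apply/all_ltP => i lt_i.
    by rewrite xE ?d01 //; lia.
  + have [y lt_y [Dy yE]] := exD (s + 1)%R; apply/has_ltP; exists y; rewrite // Dy.
    apply/all_ltP => k /splitk[lt_t lt_i ->]; apply/eqP.
    rewrite addnA -mulSn yE //; last by lia.
    by rewrite xE //; [congr (d0 _ _); lia | lia].
  + have [y lt_y [Dy yE]] := exD (s - 1)%R; apply/has_ltP; exists y; rewrite // Dy.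
    apply/all_ltP => k /splitk[lt_t lt_i ->]; apply/eqP.
    rewrite addnA -mulSn yE //; last by lia.
    by rewrite xE //; [congr (d0 _ _); lia | lia].
Qed.

End Completeness.

(** * Expansivity and half-plane diagrams *)

Section Distance.

Variables (R : realType) (gT : finGroupType) (c c' : config gT).

Lemma config_dist_le M :
  (forall i : int, absz i < M -> c i = c' i) -> (config_dist R c c' <= 2%:R ^- M)%R.
Proof.
move=> eqc; rewrite /config_dist; case: pselect => [ex|_]; last first.
  by rewrite invr_ge0 exprn_ge0.
case: ex_minnP => k /asboolP[i [<- ne_i]] _; rewrite lef_pV2 ?posrE ?exprn_gt0 //.
rewrite ler_eXn2l ?ltr1n //; rewrite leqNgt; apply/negP => lt_i.
exact: ne_i (eqc i lt_i).
Qed.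

Lemma config_dist_le_eq M : (config_dist R c c' <= 2%:R ^- M)%R ->
  forall i : int, absz i < M -> c i = c' i.
Proof.
move=> + i lt_i; apply: contraPP => ne_i; apply/negP; rewrite -ltNge /config_dist.
case: pselect => [ex|[]]; last by exists (absz i); apply/asboolP; exists i.
case: ex_minnP => k _ /(_ (absz i)) le_k.
rewrite ltf_pV2 ?posrE ?exprn_gt0 // ltr_eXn2l ?ltr1n //.
by apply: leq_ltn_trans lt_i; apply: le_k; apply/asboolP; exists i.
Qed.

End Distance.

Lemma ex_exp2V_lt (R : realType) (eps : R) :
  (0 < eps)%R -> exists M, (2%:R ^- M < eps)%R.
Proof.
move=> eps_gt0; exists (Num.bound eps^-1).
rewrite invf_plt ?posrE ?exprn_gt0 //.
apply: lt_trans (archi_boundP _) _; first by rewrite invr_ge0 ltW.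
by rewrite -natrX ltr_nat ltn_expl.
Qed.

(** Each e (t + 1) has the preimage e t, so ['pinv_id setT F] never takes its default value along
    e. *)
Lemma iterz_orbit (T : choiceType) (F : T -> T) (e : int -> T) :
  injective F -> (forall t, F (e t) = e (t + 1)%R) ->
  forall t, iterz F t (e 0%R) = e t.
Proof.
move=> injF Fe.
have pinvE t : 'pinv_id setT F (e (t + 1)%R) = e t.
  by rewrite -Fe pinvKV ?inE // => ? ? _ _; exact: injF.
case=> k /=; elim: k => [|k IHk] //.
- by rewrite iterS IHk Fe; congr e; lia.
- by rewrite -[RHS]pinvE /=; congr ('pinv_id setT F (e _)); lia.
- by rewrite iterS IHk -[RHS]pinvE; congr ('pinv_id setT F (e _)); lia.
Qed.

Lemma iterzS (T : choiceType) (F : T -> T) (t : int) (c : T) :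
  (forall b, exists a, F a = b) -> F (iterz F t c) = iterz F (t + 1)%R c.
Proof.
move=> surjF.
have pinvE b : F ('pinv_id setT F b) = b.
  by rewrite pinvK // inE; have [a <-] := surjF b; exists a.
case: t => [k|[|k]].
- by have -> : (Posz k + 1)%R = Posz k.+1 by lia.
- by rewrite /= pinvE.
- have -> : (Negz k.+1 + 1)%R = Negz k by lia.
  by rewrite /= pinvE.
Qed.

(** * Group cellular automata given by a local rule *)

Section LocalRule.

Variables (gT : finGroupType) (rho : nat).
Variables (f : (2 * rho).+1.-tuple gT -> gT) (F : config gT -> config gT).
Hypothesis gcaF : is_gca F.
Hypothesis ruleF : is_local_rule f F.

Local Notation w := (2 * rho).+1.

(** The mirrored rule turns diagrams on left half-planes into diagrams on right ones, so that only
    the latter need be studied. *)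
Definition rule_of (m : bool) (u : nat -> gT) : gT :=
  f [tuple u (if m then 2 * rho - j else j) | j < w].

Definition flip (m : bool) (i : int) : int := if m then (- i)%R else i.

Lemma flipK m : involutive (flip m).
Proof. by case: m => i; rewrite /flip ?opprK. Qed.

Lemma absz_flip m i : absz (flip m i) = absz i.
Proof. by case: m; rewrite /flip ?abszN. Qed.

Lemma rule_of_ext m u v : (forall j, j < w -> u j = v j) -> rule_of m u = rule_of m v.
Proof.
move=> uv; congr f; apply: eq_from_tnth => j; rewrite !tnth_mktuple uv //.
by have := ltn_ord j; case: m; lia.
Qed.

Lemma rule_ofM m u v :
  rule_of m (fun j => u j * v j)%g = (rule_of m u * rule_of m v)%g.
Proof.
rewrite -ruleF.1; congr f; apply: eq_from_tnth => j.
by rewrite !tnth_mktuple.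
Qed.

Lemma rule_ofE m c i :
  F c (flip m i) = rule_of m (fun j => c (flip m (i - rho%:Z + j%:Z)%R)).
Proof.
rewrite ruleF.2; congr f; apply: eq_from_tnth => j; rewrite !tnth_mktuple.
by congr c; have := ltn_ord j; rewrite /flip; case: m; lia.
Qed.

Lemma gcaM c c' i : F (fun i => c i * c' i)%g i = (F c i * F c' i)%g.
Proof. by case: gcaF => _ FM _; rewrite -[RHS]/(config_mul (F c) (F c') i) -FM. Qed.

Lemma gca1 : F (fun=> 1%g) = (fun=> 1%g).
Proof.
apply: funext => i; apply: (mulgI (F (fun=> 1%g) i)).
by rewrite -gcaM !mulg1.
Qed.

Lemma gcaV c i : F (fun i => (c i)^-1)%g i = ((F c i)^-1)%g.
Proof.
apply: (mulgI (F c i)); rewrite mulgV -gcaM -[RHS](congr1 (@^~ i) gca1).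
by congr (F _ i); apply: funext => k; rewrite mulgV.
Qed.

Lemma gca_injectiveP : injective F <->
  ~ exists2 c, in_kernel (rule_of false) c & c 0%R != 1%g.
Proof.
split=> [injF [c ker /eqP c0]|noker c c' eqF].
  suff ec : c = (fun=> 1%g) by rewrite ec in c0.
  by apply: injF; rewrite gca1; apply: funext => i; rewrite (rule_ofE false) ker.
apply: funext => i; apply: contrapT => ne_i; apply: noker.
pose d i := ((c i)^-1 * c' i)%g.
exists (fun k => d (i + k)%R) => [k|]; last by rewrite addr0 -eq_mulVg1 eq_sym; apply/eqP => /esym.
have : F d (i + k + rho%:Z)%R = 1%g by rewrite gcaM gcaV eqF mulVg.
rewrite (rule_ofE false) => h; rewrite -[RHS]h.
by congr (rule_of _ _); apply: funext => j; congr d; rewrite /flip; lia.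
Qed.

(** An injective F permutes the finitely many configurations of a given period; these approximate
    any c, and compactness turns their preimages into a preimage of c. *)
Lemma gca_injective_surjective : injective F -> forall c, exists b, F b = c.
Proof.
move=> injF c.
have shiftF (b b' : config gT) i k :
    (forall j, b (i + j)%R = b' (k + j)%R) -> F b i = F b' k.
  move=> bb'; rewrite !(rule_ofE false); congr (rule_of _ _); apply: funext => j.
  by rewrite /flip -!addrA bb'.
have /choice[b bP] : forall n, exists b : config gT,
    forall i, absz i <= n -> F b i = c i.
  (* A period of 2 n + 1 leaves the values on |i| <= n free. *)
  move=> n; pose p := (2 * n).+1.
  pose per (u : {ffun 'I_p -> gT}) : config gT := fun i => u (inord (absz (i %% p)%Z)).
  have perD u i j : per u (i + j)%R = per u ((i %% p)%Z + j)%R.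
    by rewrite /per modzDml.
  pose Phi u := [ffun k : 'I_p => F (per u) (Posz k)].
  have PhiE u i : F (per u) i = Phi u (inord (absz (i %% p)%Z)).
    have i_ge0 : (0 <= i %% p)%Z%R by rewrite modz_ge0.
    have lt_i : absz (i %% p)%Z < p by rewrite -ltz_nat gez0_abs // ltz_pmod.
    by rewrite ffunE inordK // gez0_abs //; apply: shiftF => j; rewrite perD.
  have injPhi : injective Phi.
    move=> u v eqPhi; have eqper : per u = per v.
      by apply: injF; apply: funext => i; rewrite !PhiE eqPhi.
    apply/ffunP => k; have := congr1 (@^~ (Posz k)) eqper; rewrite /per modz_nat.
    by rewrite modn_small // absz_nat inord_val.
  have [Phi' _ Phi'K] := injF_bij injPhi.
  pose u := Phi' [ffun k : 'I_p => c (k%:Z - n%:Z)%R].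
  exists (fun i => per u (i + n%:Z)%R) => i le_i.
  have -> : F (fun i => per u (i + n%:Z)%R) i = F (per u) (i + n%:Z)%R.
    by apply: shiftF => j; congr (per u); lia.
  have lt_i : absz (i + n%:Z)%R < p by rewrite /p; lia.
  rewrite PhiE Phi'K ffunE; have -> : (i + n%:Z)%R = Posz (absz (i + n%:Z)%R) by lia.
  by rewrite modz_nat absz_nat modn_small // inordK //; congr c; lia.
have [y yP] := ultra_compact (fun n i => b n i).
exists y; apply: funext => i.
have [n le_n bE] := yP [seq (i - rho%:Z + j%:Z)%R | j <- iota 0 w] (absz i).
rewrite -(bP n) // !(rule_ofE false); apply: rule_of_ext => j lt_j.
by rewrite bE //; apply/mapP; exists j; rewrite // mem_iota.
Qed.

(** Moved to distance M from the origin, the defect is an orbit that stays within 2^-M of the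
    trivial one at all times. *)
Lemma defect_not_expansive (R : realType) m :
  injective F -> defective rho (rule_of m) -> ~ expansive R F.
Proof.
move=> injF [d [hd d1 d0]] [_ [eps [eps_gt0 expF]]].
have [M ltM] := ex_exp2V_lt eps_gt0.
(* Column 2 rho of d, the first nontrivial one, is placed at position M or - M. *)
pose col (i : int) := (flip m i - M%:Z + (2 * rho)%:Z)%R.
pose e (t : int) : config gT := fun i => if (col i < 0)%R then 1%g else d t (absz (col i)).
have eF t : F (e t) = e (t + 1)%R.
  apply: funext => i; rewrite -[i](flipK m) rule_ofE /e.
  have colE k : col (flip m k) = (k - M%:Z + (2 * rho)%:Z)%R by rewrite /col flipK.
  (* A window starting left of column 0 lies entirely left of column 2 rho, where everything is
     trivial. *)
  set k := flip m i; have [lt0|ge0] := ltP (col (flip m (k - rho%:Z)%R)) 0%R.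
    transitivity (1%g : gT); last first.
      by case: ifP => // ge; rewrite d1 //; move: lt0 ge; rewrite !colE; lia.
    rewrite -[RHS](pointwise_hom1 (rule_ofM m)); apply: rule_of_ext => j lt_j.
    by case: ifP => // ge; rewrite d1 //; move: lt0 ge; rewrite !colE; lia.
  have -> : (col (flip m k) < 0)%R = false by move: ge0; rewrite !colE; lia.
  have -> : absz (col (flip m k)) = absz (col (flip m (k - rho%:Z)%R)) + rho.
    by move: ge0; rewrite !colE; lia.
  rewrite hd; apply: rule_of_ext => j lt_j.
  have -> : (col (flip m (k - rho%:Z + j%:Z)%R) < 0)%R = false.
    by move: ge0; rewrite !colE; lia.
  by congr (d t); move: ge0; rewrite !colE; lia.
have [|n] := expF (e 0%R) (fun=> 1%g).
  move/(congr1 (@^~ (flip m (Posz M)))); rewrite /e /col flipK subrr add0r.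
  by move: d0 => /[swap] /= ->; rewrite eqxx.
rewrite (iterz_orbit injF eF) (@iterz_orbit _ F (fun _ _ => 1%g) injF) => [|t]; last exact: gca1.
apply/negP; rewrite -leNgt; apply: le_trans (ltW ltM); apply: config_dist_le => i lt_i.
rewrite /e; case: ifP => // ge0; apply: d1; move: ge0; rewrite /col.
by have := absz_flip m i; lia.
Qed.

(** The quotient of two orbits that stay close is trivial around the origin at all times; its first
    nontrivial column on one side yields the defect. *)
Lemma not_expansive_defect (R : realType) :
  injective F -> ~ expansive R F -> exists m, defective rho (rule_of m).
Proof.
move=> injF nexpF; have surjF := gca_injective_surjective injF.
apply: contrapT => ndef; apply: nexpF; split=> //.
(* Orbits never further apart than this agree on |i| <= 2 rho, which leaves 2 rho trivial columns
   before the first nontrivial one on either side. *)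
exists (2%:R ^- w)%R; split; first by rewrite invr_gt0 exprn_gt0.
move=> c c' ne_c; apply: contrapT => /forallNP le_dist.
pose d t i := ((iterz F t c i)^-1 * iterz F t c' i)%g.
have d1 t i : absz i < w -> d t i = 1%g.
  move=> lt_i; rewrite /d (@config_dist_le_eq R _ (iterz F t c) (iterz F t c') w) ?mulVg //.
  by rewrite leNgt; apply/negP/le_dist.
have dF t i : F (d t) i = d (t + 1)%R i by rewrite gcaM gcaV !iterzS.
have [i d0i] : exists i, d 0%R i != 1%g.
  apply: contrapT => /forallNP d01; apply: ne_c; apply: funext => i.
  by have /negP/negPn := d01 i; rewrite /d /= -eq_mulVg1 => /eqP.
apply: ndef; exists (i < 0)%R.
set m := (i < 0)%R.
have exk : exists k, `[< exists t, d t (flip m (Posz k)) != 1%g >].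
  exists (absz i); apply/asboolP; exists 0%R; congr (d _ _ != _): d0i.
  by rewrite /flip /m; case: ltP; lia.
(* On the chosen side, k is the position nearest to the origin that is nontrivial at some time
   t0. *)
have /= := ex_minnP exk; case: (ex_minn exk) / => k /asboolP[t0 dk] mink.
have gt_k : 2 * rho < k.
  rewrite ltnNge; apply/negP => le_k; move/eqP: dk; apply.
  by rewrite d1 // absz_flip absz_nat.
exists (fun t j => d (t0 + t)%R (flip m ((k - 2 * rho)%:Z + j%:Z)%R)); split.
- move=> t j; rewrite addrA -dF rule_ofE; apply: rule_of_ext => l _.
  by congr (d _ (flip m _)); lia.
- move=> t j lt_j; apply/eqP; apply: contraT => ne1.
  suff /mink : `[< exists t, d t (flip m (Posz (k - 2 * rho + j))) != 1%g >] by lia.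
  by apply/asboolP; exists (t0 + t)%R; rewrite PoszD.
by rewrite addr0 -PoszD subnK // ltnW.
Qed.

Lemma expansiveP (R : realType) : expansive R F <->
  (~ exists2 c, in_kernel (rule_of false) c & c 0%R != 1%g) /\
  forall m, ~ defective rho (rule_of m).
Proof.
split=> [expF|[/gca_injectiveP injF ndef]].
  have [injF _] := expF; split; first exact/gca_injectiveP.
  by move=> m /(@defect_not_expansive R m injF).
by apply: contrapT => /(not_expansive_defect injF)[m /ndef].
Qed.

End LocalRule.

(** * The search program *)

Section Transfer.

Variables (T T' : eqType) (one : T) (one' : T').
Variables (rd : nat -> nat -> T) (rd' : nat -> nat -> T').
Variables (phi : (nat -> T) -> T) (phi' : (nat -> T') -> T') (g rho : nat).
Hypothesis eq_rd : forall x k y l, (rd x k == rd y l) = (rd' x k == rd' y l).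
Hypothesis eq_one : forall x k, (rd x k == one) = (rd' x k == one').
Hypothesis eq_phi_rd : forall x (p : nat -> nat) y l,
  (phi (fun j => rd x (p j)) == rd y l) = (phi' (fun j => rd' x (p j)) == rd' y l).
Hypothesis eq_phi_one : forall x (p : nat -> nat),
  (phi (fun j => rd x (p j)) == one) = (phi' (fun j => rd' x (p j)) == one').

Local Ltac transfer := repeat first
  [ reflexivity | exact: eq_rd | exact: eq_one | exact: eq_phi_rd
  | exact: eq_phi_one | apply: eq_all_lt => ? _ | apply: eq_has_lt => ? _
  | congr (_ ==> _) | congr (_ && _) ].

(** The checks only compare letters, values of phi and the identity, so readings that agree on these
    comparisons give the same result; likewise for the next three lemmas. *)
Lemma eq_inj_check n : inj_check one rd phi g rho n = inj_check one' rd' phi' g rho n.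
Proof. by rewrite /inj_check; transfer. Qed.

Lemma eq_inj_cert D : inj_cert one rd phi g rho D = inj_cert one' rd' phi' g rho D.
Proof. by rewrite /inj_cert; transfer. Qed.

Lemma eq_trivial_check n :
  trivial_check one rd phi g rho n = trivial_check one' rd' phi' g rho n.
Proof. by rewrite /trivial_check; transfer. Qed.

Lemma eq_defect_cert h N C D :
  defect_cert one rd phi g rho h N C D = defect_cert one' rd' phi' g rho h N C D.
Proof.
rewrite /defect_cert /lang_cert /start_cert /step_cert /column_cert.
by rewrite /is_path /in_lang /follows; transfer.
Qed.

End Transfer.

(* [CodeSeq.code (n :: l)] is 2 ^ n * (2 * code l + 1), so the head of a coded
   sequence is a 2-adic valuation. *)
Definition code_head (c : nat) : nat := \sum_(n < c) (2 ^ n.+1 %| c).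
Definition code_tail (c : nat) : nat := c %/ 2 ^ code_head c %/ 2.
Definition code_nth (c k : nat) : nat := code_head (iter k code_tail c).

Lemma code_head_cons n m : code_head (2 ^ n * m.*2.+1) = n.
Proof.
have m_gt0 : 0 < 2 ^ n * m.*2.+1 by rewrite muln_gt0 expn_gt0.
rewrite /code_head -[RHS](@sum_ltn_ord n (2 ^ n * m.*2.+1)); last first.
  by apply: leq_trans (ltnW (ltn_expl n (ltnSn 1))) _; rewrite leq_pmulr.
apply: eq_bigr => i _; congr nat_of_bool; rewrite pfactor_dvdn //.
by rewrite lognM ?expn_gt0 // pfactorK // lognE dvdn2 /= odd_double addn0.
Qed.

Lemma code_tail_cons n m : code_tail (2 ^ n * m.*2.+1) = m.
Proof.
rewrite /code_tail code_head_cons mulKn ?expn_gt0 //.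
by rewrite divn2 -[m.*2.+1]/(true + m.*2) half_bit_double.
Qed.

Lemma code_nthE l k : code_nth (CodeSeq.code l) k = nth 0 l k.
Proof.
have head0 : code_head 0 = 0 by rewrite /code_head big_ord0.
have tail0 j : iter j code_tail 0 = 0.
  by elim: j => //= j ->; rewrite /code_tail !div0n.
elim: k l => [|k IHk] [|n l].
- exact: head0.
- exact: code_head_cons.
- by rewrite /code_nth tail0.
- by rewrite /code_nth iterSr /= code_tail_cons; exact: IHk.
Qed.

Definition sum_lt (n : nat) (u : nat -> nat) : nat := \sum_(i < n) u i.

(* The rule with table c, or its mirror image if m holds; the table index of a
   word is its value in base g, most significant letter first. *)
Definition table_rule (m : bool) (g rho c : nat) (u : nat -> nat) : nat :=
  code_nth c (sum_lt (2 * rho).+1 (fun j =>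
    u (if m then 2 * rho - j else j) * g ^ (2 * rho - j))).

Lemma nth_allpairs (S T U : Type) (op : S -> T -> U) s t x0 y0 z0 i j :
  i < size s -> j < size t ->
  nth z0 [seq op x y | x <- s, y <- t] (i * size t + j) = op (nth x0 s i) (nth y0 t j).
Proof.
elim: s i => [|x s IHs] [|i] //= lt_i lt_j; rewrite nth_cat size_map.
  by rewrite mul0n add0n lt_j (nth_map y0).
by rewrite mulSn -addnA ltnNge leq_addr /= addKn IHs.
Qed.

Lemma size_words (T : Type) (s : seq T) m : size (words s m) = size s ^ m.
Proof. by elim: m => // m IHm; rewrite /= size_allpairs IHm expnS. Qed.

Lemma nth_words (T : Type) (s : seq T) x0 m w0 (v : nat -> nat) :
  (forall j, v j < size s) ->
  sum_lt m (fun j => v j * size s ^ (m.-1 - j)) < size s ^ m /\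
  nth w0 (words s m) (sum_lt m (fun j => v j * size s ^ (m.-1 - j))) =
    [tuple nth x0 s (v j) | j < m].
Proof.
move=> v_lt; elim: m w0 v v_lt => [|m IHm] w0 v v_lt.
  by rewrite /sum_lt big_ord0; split=> //; apply: val_inj; rewrite /= enum_ord0.
rewrite /sum_lt big_ord_recl /= subn0.
have -> : \sum_(i < m) v (lift ord0 i) * size s ^ (m - lift ord0 i) =
    sum_lt m (fun j => v j.+1 * size s ^ (m.-1 - j)).
  by apply: eq_bigr => i _; congr (_ * _ ^ _); rewrite lift0; lia.
have [|lt_m nthE] := IHm (behead_tuple w0) (fun j => v j.+1) => //.
split; first by rewrite expnS ltn_cell.
rewrite -size_words (nth_allpairs _ x0 (behead_tuple w0)) ?size_words //.
rewrite nthE; apply: eq_from_tnth => j; rewrite tnth_mktuple.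
case: (unliftP ord0 j) => [i|] ->; last by rewrite tnth0.
by rewrite tnthS tnth_mktuple.
Qed.

(** * Reading the group and the rule from their tables *)

Section Tables.

Variables (gT : finGroupType) (s : seq gT) (rho : nat).
Variable f : (2 * rho).+1.-tuple gT -> gT.
Hypothesis s_enum : Finite.axiom s.

Local Notation g := (size s).
Local Notation e := (index 1%g s).
Local Notation rule m := (table_rule m g rho (CodeSeq.code (rule_table s f))).
Local Notation mul_code := (CodeSeq.code (mul_table s)).

Definition read (x k : nat) : gT := nth 1%g s (digit g x k).

Lemma enum_mem x : x \in s.
Proof. by rewrite -has_pred1 has_count s_enum. Qed.

Lemma enum_uniq : uniq s.
Proof. by apply: count_mem_uniq => x; rewrite s_enum enum_mem. Qed.

Lemma index_enum_lt x : index x s < g.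
Proof. by rewrite index_mem enum_mem. Qed.

Lemma enum_size_gt0 : 0 < g.
Proof. exact: leq_ltn_trans (index_enum_lt 1%g). Qed.

Lemma digit_lt x k : digit g x k < g.
Proof. by rewrite ltn_mod enum_size_gt0. Qed.

Lemma read_surj (u : nat -> gT) M :
  exists2 x, x < g ^ M & forall k, k < M -> read x k = u k.
Proof.
have [|x lt_x xE] := @digit_surj g (fun k => index (u k) s) M.
  by move=> k; exact: index_enum_lt.
by exists x => // k lt_k; rewrite /read xE // nth_index // enum_mem.
Qed.

Lemma table_ruleE m x (p : nat -> nat) :
  rule m (fun j => digit g x (p j)) = index (rule_of f m (fun j => read x (p j))) s.
Proof.
rewrite /table_rule code_nthE.
pose v j := digit g x (p (if m then 2 * rho - j else j)).
have [lt_v nthv] := @nth_words _ s 1%g (2 * rho).+1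
  [tuple 1%g | _ < (2 * rho).+1] v (fun=> digit_lt _ _).
by rewrite (nth_map [tuple 1%g | _ < (2 * rho).+1]) ?size_words // nthv.
Qed.

Lemma eq_index_digit a x k : (index a s == digit g x k) = (a == read x k).
Proof.
rewrite -{2}(nth_index 1%g (enum_mem a)) nth_uniq ?enum_uniq ?digit_lt //.
exact: index_enum_lt.
Qed.

Lemma eq_digit x k y l : (digit g x k == digit g y l) = (read x k == read y l).
Proof. by rewrite nth_uniq ?digit_lt ?enum_uniq. Qed.

Lemma eq_digit_one x k : (digit g x k == e) = (read x k == 1%g).
Proof. by rewrite eq_sym eq_index_digit eq_sym. Qed.

Lemma eq_rule_digit m x (p : nat -> nat) y l :
  (rule m (fun j => digit g x (p j)) == digit g y l) =
  (rule_of f m (fun j => read x (p j)) == read y l).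
Proof. by rewrite table_ruleE eq_index_digit. Qed.

Lemma eq_rule_one m x (p : nat -> nat) :
  (rule m (fun j => digit g x (p j)) == e) =
  (rule_of f m (fun j => read x (p j)) == 1%g).
Proof.
rewrite table_ruleE; apply/eqP/eqP => [|-> //].
by move/(congr1 (nth 1%g s)); rewrite !nth_index ?enum_mem.
Qed.

(* The program recognises the identity as the only idempotent. *)
Lemma mul_table_idempotent i : i < g ->
  (code_nth mul_code (i * g + i) == i) = (i == e).
Proof.
move=> lt_i; rewrite code_nthE /mul_table.
rewrite (@nth_allpairs _ _ _ (fun x y => index (x * y)%g s) _ _ 1%g 1%g) //.
set x := nth 1%g s i; have {1 2}-> : i = index x s by rewrite index_uniq ?enum_uniq.
apply/eqP/eqP => [|iE]; last first.
  by rewrite -[x](nth_index 1%g (enum_mem x)) iE nth_index ?enum_mem // mulg1.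
move/(congr1 (nth 1%g s)); rewrite !nth_index ?enum_mem // => /(canRL (mulKg x)).
by rewrite mulVg => ->.
Qed.

End Tables.

(** A single z bounds all witnesses, so that one search over z meets every tuple of them; the two
    orientations are tested separately. *)
Definition accepts (z g mc rho fc : nat) : bool :=
  has_lt g (fun e => (code_nth mc (e * g + e) == e) &&
    (has_lt z.+1 (fun n => inj_check e (digit g) (table_rule false g rho fc) g rho n) &&
    (has_lt z.+1 (fun n => trivial_check e (digit g) (table_rule false g rho fc) g rho n) &&
     has_lt z.+1 (fun n => trivial_check e (digit g) (table_rule true g rho fc) g rho n)))).

Definition has_defect (m : bool) (z e g rho fc : nat) : bool :=
  has_lt z.+1 (fun h => has_lt z.+1 (fun N => has_lt z.+1 (fun C => has_lt z.+1 (fun D =>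
    defect_cert e (digit g) (table_rule m g rho fc) g rho h N C D)))).

Definition rejects (z g mc rho fc : nat) : bool :=
  has_lt g (fun e => (code_nth mc (e * g + e) == e) &&
    (has_lt z.+1 (fun D => inj_cert e (digit g) (table_rule false g rho fc) g rho D) ||
    (has_defect false z e g rho fc || has_defect true z e g rho fc))).

(** * Soundness and completeness of acceptance and rejection *)

Section Correctness.

Variables (R : realType) (gT : finGroupType) (s : seq gT) (rho : nat).
Variables (f : (2 * rho).+1.-tuple gT -> gT) (F : config gT -> config gT).
Hypotheses (s_enum : Finite.axiom s) (gcaF : is_gca F) (ruleF : is_local_rule f F).

Local Notation g := (size s).
Local Notation e := (index 1%g s).
Local Notation fc := (CodeSeq.code (rule_table s f)).
Local Notation mc := (CodeSeq.code (mul_table s)).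

Let rsurj := read_surj s_enum.
Let rext m u v := @rule_of_ext gT rho f m u v.
Let rM m := rule_ofM ruleF m.

Lemma has_identity (P : pred nat) :
  has_lt g (fun i => (code_nth mc (i * g + i) == i) && P i) = P e.
Proof.
apply/has_ltP/idP => [[i lt_i]|Pe].
  by rewrite mul_table_idempotent // => /andP[/eqP->].
by exists e; rewrite ?index_enum_lt // mul_table_idempotent ?index_enum_lt // eqxx.
Qed.

Let num_inj_check n : inj_check e (digit g) (table_rule false g rho fc) g rho n =
  inj_check 1%g (read s) (rule_of f false) g rho n.
Proof.
by apply: eq_inj_check => *;
  rewrite ?eq_digit ?eq_digit_one ?eq_rule_digit ?eq_rule_one.
Qed.

Let num_inj_cert n : inj_cert e (digit g) (table_rule false g rho fc) g rho n =
  inj_cert 1%g (read s) (rule_of f false) g rho n.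
Proof.
by apply: eq_inj_cert => *;
  rewrite ?eq_digit ?eq_digit_one ?eq_rule_digit ?eq_rule_one.
Qed.

Let num_trivial_check m n : trivial_check e (digit g) (table_rule m g rho fc) g rho n =
  trivial_check 1%g (read s) (rule_of f m) g rho n.
Proof.
by apply: eq_trivial_check => *;
  rewrite ?eq_digit ?eq_digit_one ?eq_rule_digit ?eq_rule_one.
Qed.

Let num_defect_cert m h N C D :
  defect_cert e (digit g) (table_rule m g rho fc) g rho h N C D =
  defect_cert 1%g (read s) (rule_of f m) g rho h N C D.
Proof.
by apply: eq_defect_cert => *;
  rewrite ?eq_digit ?eq_digit_one ?eq_rule_digit ?eq_rule_one.
Qed.

(** A kernel element would have a certificate, and a certificate refutes the checks of all sizes.
    The next lemma argues in the same way for defects. *)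
Lemma inj_check_no_kernel n : inj_check 1%g (read s) (rule_of f false) g rho n ->
  ~ exists2 c, in_kernel (rule_of f false) c & c 0%R != 1%g.
Proof.
move=> chk [c ker c0].
have [D /(inj_cert_sound rsurj (@rext false) n)] := inj_cert_complete rsurj (@rext false) ker c0.
by rewrite chk.
Qed.

Lemma trivial_check_no_defect m n : trivial_check 1%g (read s) (rule_of f m) g rho n ->
  ~ defective rho (rule_of f m).
Proof.
move=> chk /(defect_cert_complete rsurj (@rext m) (rM m)) [h [N [C [D]]]].
case/and5P => h_gt1 lC stC spC cC.
by have := defect_cert_sound rsurj (@rext m) h_gt1 lC stC spC cC n; rewrite chk.
Qed.

Lemma accepts_sound z : accepts z g mc rho fc -> expansive R F.
Proof.
rewrite /accepts has_identity => /and3P[/has_ltP[n _ chk] /has_ltP[n0 _ chk0] /has_ltP[n1 _ chk1]].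
apply/(expansiveP gcaF ruleF); split.
  by apply: (@inj_check_no_kernel n); rewrite -num_inj_check.
by case; [apply: (@trivial_check_no_defect _ n1) | apply: (@trivial_check_no_defect _ n0)];
  rewrite -num_trivial_check.
Qed.

Lemma accepts_complete : expansive R F -> exists z, accepts z g mc rho fc.
Proof.
move/(expansiveP gcaF ruleF) => [noker nodef].
have [n chk] : exists n, inj_check 1%g (read s) (rule_of f false) g rho n.
  apply: contrapT => /forallNP nchk; apply: noker.
  by apply: ex_kernel (@rext false) _ => n; apply/negP/nchk.
have chkm m : exists n, trivial_check 1%g (read s) (rule_of f m) g rho n.
  apply: contrapT => /forallNP nchk; apply: (nodef m).
  by apply: ex_defect (@rext m) _ => n'; apply/negP/nchk.
have [[n0 chk0] [n1 chk1]] := (chkm false, chkm true).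
exists (n + (n0 + n1)); rewrite /accepts has_identity; apply/and3P; split; apply/has_ltP.
- by exists n; [lia | rewrite num_inj_check].
- by exists n0; [lia | rewrite num_trivial_check].
- by exists n1; [lia | rewrite num_trivial_check].
Qed.

(** A certificate refutes the checks of all sizes, and compactness then yields a kernel element or a
    defect. *)
Lemma rejects_sound z : rejects z g mc rho fc -> ~ expansive R F.
Proof.
rewrite /rejects has_identity => rej /(expansiveP gcaF ruleF) [noker nodef].
have defF m : ~~ has_defect m z e g rho fc.
  apply/negP => /has_ltP[h _ /has_ltP[N _ /has_ltP[C _ /has_ltP[D _]]]].
  rewrite num_defect_cert => /and5P[h_gt1 lC stC spC cC]; apply: (nodef m).
  apply: ex_defect (@rext m) _ => n.
  exact: (defect_cert_sound rsurj (@rext m) h_gt1 lC stC spC cC).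
move: rej; rewrite (negbTE (defF _)) (negbTE (defF _)) !orbF => /has_ltP[D _].
rewrite num_inj_cert => cD; apply: noker; apply: ex_kernel (@rext false) _ => n.
exact: (inj_cert_sound rsurj (@rext false) n cD).
Qed.

Lemma rejects_complete : ~ expansive R F -> exists z, rejects z g mc rho fc.
Proof.
move=> nexpF.
have [[c ker c0]|noker] := EM (exists2 c, in_kernel (rule_of f false) c & c 0%R != 1%g).
  have [D cD] := inj_cert_complete rsurj (@rext false) ker c0.
  exists D; rewrite /rejects has_identity; apply/orP; left; apply/has_ltP.
  by exists D; rewrite ?num_inj_cert.
have [m defm] : exists m, defective rho (rule_of f m).
  apply: contrapT => /forallNP nodef; apply: nexpF.
  exact/(expansiveP gcaF ruleF).
have [h [N [C [D cert]]]] := defect_cert_complete rsurj (@rext m) (rM m) defm.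
exists (h + (N + (C + D))); rewrite /rejects has_identity; apply/orP; right.
have : has_defect m (h + (N + (C + D))) e g rho fc; last first.
  by case: (m) => ->; rewrite ?orbT.
apply/has_ltP; exists h; first by lia.
apply/has_ltP; exists N; first by lia.
apply/has_ltP; exists C; first by lia.
by apply/has_ltP; exists D; [lia | rewrite num_defect_cert].
Qed.

End Correctness.

(** * Computability of the search predicates *)

Lemma computable_digit k b x i : computable k b -> computable k x -> computable k i ->
  computable k (fun xs => digit (b xs) (x xs) (i xs)).
Proof.
move=> cb cx ci; apply: computable_mod => //.
by apply: computable_div => //; exact: computable_exp.
Qed.

Lemma computable_sum_lt k n (u : nat -> seq nat -> nat) : computable k n ->
  computable k.+1 (fun ys => u (nth 0 ys 0) (behead ys)) ->
  computable k (fun xs => sum_lt (n xs) (fun i => u i xs)).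
Proof. exact: computable_sum. Qed.

Lemma computable_code_head k c : computable k c ->
  computable k (fun xs => code_head (c xs)).
Proof.
move=> cc; apply: (computable_sum (F := fun i xs => 2 ^ i.+1 %| c xs)) => //.
apply: decidable_eq; last exact: computable_const.
apply: computable_mod; first exact: computable_behead.
apply: computable_exp; first exact: computable_const.
by apply: computable_succ; exact: computable_nth.
Qed.

Lemma computable_code_nth k c i : computable k c -> computable k i ->
  computable k (fun xs => code_nth (c xs) (i xs)).
Proof.
move=> cc ci; apply: computable_code_head.
apply: (eq_computable (F := fun xs =>
  nat_rect (fun=> nat) (c xs) (fun _ r => code_tail r) (i xs))).
  by move=> xs; elim: (i xs) => //= n ->.
apply: computable_rec => //; apply: computable_div; last exact: computable_const.
apply: computable_div; first exact: computable_nth.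
apply: computable_exp; first exact: computable_const.
by apply: computable_code_head; exact: computable_nth.
Qed.

Lemma decidable_bit k c i : computable k c -> computable k i ->
  decidable_pred k (fun xs => bit (c xs) (i xs)).
Proof.
move=> cc ci; apply: decidable_eq; last exact: computable_const.
by apply: computable_digit => //; exact: computable_const.
Qed.

(** Under nested quantifiers a variable is an entry of an iterated [behead]; this raises its index
    instead, as with de Bruijn indices. *)
Lemma computable_nth_behead k (b : seq nat -> seq nat) i :
  computable k (fun xs => nth 0 (b xs) i.+1) ->
  computable k (fun xs => nth 0 (behead (b xs)) i).
Proof. by apply: eq_computable => xs; rewrite nth_behead. Qed.

Local Ltac computability := cbv beta; lazymatch goal with
  | |- decidable_pred _ (fun xs => all_lt (@?n xs) (@?P xs)) =>
      refine (@decidable_all_lt _ n (fun i xs => P xs i) _ _)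
  | |- decidable_pred _ (fun xs => has_lt (@?n xs) (@?P xs)) =>
      refine (@decidable_has_lt _ n (fun i xs => P xs i) _ _)
  | |- decidable_pred _ (fun xs => @?b xs ==> @?c xs) => apply: decidable_imply
  | |- decidable_pred _ (fun xs => @?b xs && @?c xs) => apply: decidable_and
  | |- decidable_pred _ (fun xs => @?b xs || @?c xs) => apply: decidable_or
  | |- decidable_pred _ (fun xs => ~~ @?b xs) => apply: decidable_neg
  | |- decidable_pred _ (fun xs => bit (@?a xs) (@?b xs)) => apply: decidable_bit
  | |- decidable_pred _ (fun xs => @?a xs <= @?b xs) => apply: decidable_leq
  | |- decidable_pred _ (fun xs => @?a xs == @?b xs) => apply: decidable_eq
  | |- computable _ (fun xs => nth 0 (behead (@?b xs)) ?i) =>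
      refine (@computable_nth_behead _ b i _)
  | |- computable _ (fun xs => nth 0 xs ?i) => exact: computable_nth
  | |- computable _ (fun _ => ?n) => exact: computable_const
  | |- computable _ (fun xs => sum_lt (@?n xs) (@?u xs)) =>
      refine (@computable_sum_lt _ n (fun i xs => u xs i) _ _)
  | |- computable _ (fun xs => digit (@?a xs) (@?b xs) (@?c xs)) =>
      apply: computable_digit
  | |- computable _ (fun xs => code_nth (@?a xs) (@?b xs)) =>
      apply: computable_code_nth
  | |- computable _ (fun xs => @?a xs + @?b xs) => apply: computable_add
  | |- computable _ (fun xs => @?a xs - @?b xs) => apply: computable_sub
  | |- computable _ (fun xs => @?a xs * @?b xs) => apply: computable_mul
  | |- computable _ (fun xs => @?a xs ^ @?b xs) => apply: computable_exp
  | |- computable _ (fun xs => (@?a xs).+1) => apply: computable_succ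
  | |- computable _ (fun xs => (@?a xs).-1) => apply: computable_pred
  end.

Lemma decidable_accepts : decidable_pred 5 (fun xs =>
  accepts (nth 0 xs 0) (nth 0 xs 1) (nth 0 xs 2) (nth 0 xs 3) (nth 0 xs 4)).
Proof.
rewrite /accepts /inj_check /trivial_check /table_rule.
by repeat computability.
Qed.

Lemma decidable_rejects : decidable_pred 5 (fun xs =>
  rejects (nth 0 xs 0) (nth 0 xs 1) (nth 0 xs 2) (nth 0 xs 3) (nth 0 xs 4)).
Proof.
rewrite /rejects /has_defect /inj_cert /defect_cert /lang_cert /start_cert.
rewrite /step_cert /column_cert /is_path /in_lang /follows /table_rule.
by repeat computability.
Qed.

Theorem theorem7 :
  exists p : recfun,
    forall (R : realType) (gT : finGroupType) (s : seq gT) (rho : nat)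
      (f : (2 * rho).+1.-tuple gT -> gT) (F : config gT -> config gT),
      Finite.axiom s -> is_gca F -> is_local_rule f F ->
      answers p (gca_input s f) (expansive R F).
Proof.
(* The five arguments are the bound z and the four numbers of the input. *)
have [p pP] := computable_search decidable_accepts decidable_rejects.
exists p => R gT s rho f F s_enum gcaF ruleF; apply: pP => //=.
- exact: accepts_complete.
- exact: rejects_complete.
- exact: accepts_sound.
- exact: rejects_sound.
Qed.
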